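(* Let $g:\Omega\times[0,T]\times\mathbb{R}\times\mathbb{R}^d\to\mathbb{R}$ and $\phi:\Omega\times[0,T]\times\mathbb{R}\times\mathbb{R}^d\to\mathbb{R}^+$ be two functions each of which is convex in $(y,z)$, uniformly Lipschitz in $(y,z)$ (there is a constant $M>0$ with $|f(\omega,t,y_1,z_1)-f(\omega,t,y_2,z_2)|\le M(|y_1-y_2|+|z_1-z_2|)$ for all $\omega,t$ and all $(y_1,z_1),(y_2,z_2)\in\mathbb{R}\times\mathbb{R}^d$, for $f=g$ and $f=\phi$) and vanishes at $z=0$ ($g(\omega,t,y,0)=0$ and $\phi(\omega,t,y,0)=0$ for all $\omega,t,y$). Let $$D:=\{\xi\in L_T^2(\mathbb{R}):-\infty<\mathcal{E}_0^{g,\phi}(\xi)<\infty\},$$ assume that $D$ is norm closed in $L_T^2(\mathbb{R})$, and let $\mathring{D}$ denote the interior of $D$ in $L_T^2(\mathbb{R})$. If $\xi\in\mathring{D}$ and $(\xi_n)_{n\ge1}$ is a sequence in $\mathring{D}$ with $E|\xi_n-\xi|^2\to0$ as $n\to\infty$, then for every $t\in[0,T]$, $$E\big|\mathcal{E}_t^{g,\phi}(\xi_n)-\mathcal{E}_t^{g,\phi}(\xi)\big|^2\to0\quad\text{as } n\to\infty.$$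
   Context: $T>0$ is a fixed deterministic time, $(W_t)_{t\ge0}$ is a standard $d$-dimensional Brownian motion on a complete probability space $(\Omega,\mathcal{F},P)$, and $(\mathcal{F}_t)_{0\le t\le T}$ is its natural filtration augmented by the $P$-null sets. $L_T^2(\mathbb{R})$ is the space of $\mathcal{F}_T$-measurable random variables $\xi$ with $E|\xi|^2<\infty$. The functions $g$ and $\phi$ are assumed to be such that $g(\cdot,\cdot,y,z)$ and $\phi(\cdot,\cdot,y,z)$ are predictable for each $(y,z)$. For $\xi\in L_T^2(\mathbb{R})$, a $g$-super-solution with terminal value $\xi$ is a triple $(y,z,C)$, where $y$ is a real-valued adapted RCLL process with $E\sup_{t\le T}|y_t|^2<\infty$, $z$ is an $\mathbb{R}^d$-valued predictable process with $E\int_0^T|z_s|^2ds<\infty$, and $C$ is an adapted RCLL increasing process with $C_0=0$ and $E|C_T|^2<\infty$, such that $$y_t=\xi+\int_t^T g(s,y_s,z_s)\,ds-\int_t^T z_s^*\,dW_s+C_T-C_t,\qquad 0\le t\le T.$$ The constraint is $(y_t,z_t)\in\Gamma_t:=\{(y,z)\in\mathbb{R}\times\mathbb{R}^d:\phi(t,y,z)=0\}$, a.e. on $[0,T]\times\Omega$. $\mathcal{H}^{\phi}(\xi)$ denotes the set of $g$-super-solutions with terminal value $\xi$ satisfying the constraint. When $\mathcal{H}^\phi(\xi)\ne\emptyset$, there is a minimal element $(y,z,C)\in\mathcal{H}^\phi(\xi)$, i.e. such that $y_t\le y'_t$ a.e. for every $(y',z',C')\in\mathcal{H}^\phi(\xi)$;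 its first component is called the $g_\Gamma$-solution and is denoted $\mathcal{E}_t^{g,\phi}(\xi):=y_t$, $t\in[0,T]$. When $\mathcal{H}^\phi(\xi)=\emptyset$, one sets $\mathcal{E}_0^{g,\phi}(\xi)=+\infty$, so that $D$ is the set of $\xi$ with $\mathcal{H}^\phi(\xi)\neq\emptyset$ and $\mathcal{E}_0^{g,\phi}(\xi)$ finite. *)

(* Defs.v *)
From HB Require Import structures.
From mathcomp Require Import all_boot all_order all_algebra.
From mathcomp Require Import all_classical all_reals all_analysis.
Import Order.TTheory GRing.Theory Num.Theory.
Import numFieldNormedType.Exports.
Set Implicit Arguments.
Unset Strict Implicit.
Unset Printing Implicit Defensive.

Local Open Scope classical_set_scope.
Local Open Scope ring_scope.

(** The sup norm is the library norm on ['rV[R]_d]; this is the Euclidean one. *)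
Definition enorm (R : realType) (d : nat) (z : 'rV[R]_d) : R :=
  Num.sqrt (\sum_(i < d) z 0 i ^+ 2).

(** Processes are curried functions of (t, omega) with t in the whole of R;
    only their values at times in [0, T] (in [0, +oo[ for [W]) matter. *)
Section processes.
Context (R : realType) (disp : measure_display) (Omega : measurableType disp).
Context (P : probability Omega R) (d : nat) (W : R -> Omega -> 'rV[R]_d).

(** sigma(W_u : 0 <= u <= t) *)
Definition natural_sigma (t : R) : set (set Omega) :=
  <<s [set A | exists (u : R) (i : 'I_d) (B : set R),
         [/\ 0 <= u <= t, measurable B & A = [set w | B (W u w 0 i)]]] >>.

(** The last clause says at once that W_t - W_s has independent components
    of law N(0, t - s) and is independent of the past up to time s.  The second
    parameter of [normal_prob] is the standard deviation. *)
Record brownian_motion : Prop := {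
  bm_measurable : forall (t : R) i, 0 <= t -> measurable_fun setT (fun w => W t w 0 i);
  bm_start : {ae P, forall w, W 0 w = 0};
  bm_continuous : {ae P, forall w, forall i,
    {within `[0, +oo[, continuous (fun t => W t w 0 i)}};
  bm_increments : forall (s t : R) (A : set Omega) (B : 'I_d -> set R),
    0 <= s -> s < t -> natural_sigma s A -> (forall i, measurable (B i)) ->
    P (A `&` [set w | forall i, B i (W t w 0 i - W s w 0 i)]) =
    (P A * \prod_(i < d) normal_prob 0 (Num.sqrt (t - s)) (B i))%E }.

(** F_t : the natural filtration augmented by the P-null sets *)
Definition filtration (t : R) : set (set Omega) :=
  <<s natural_sigma t `|` P.-negligible >>.

Definition measurable_wrt (G : set (set Omega)) (X : Omega -> R) : Prop :=
  forall B : set R, measurable B -> G (X @^-1` B).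

Context (T : R).

Definition adapted (X : R -> Omega -> R) : Prop :=
  forall t : R, 0 <= t <= T -> measurable_wrt (filtration t) (X t).

Definition predictable_sets : set (set (R * Omega)) :=
  <<s [set` `[0, T]] `*` setT,
      [set [set 0] `*` A | A in filtration 0] `|`
      [set D | exists (s t : R) A,
         [/\ 0 <= s, s <= t, t <= T, filtration s A & D = [set` `]s, t]] `*` A]] >>.

Definition predictable (X : R -> Omega -> R) : Prop :=
  forall B : set R, measurable B ->
  predictable_sets [set p | (0 <= p.1 <= T) /\ B (X p.1 p.2)].

Definition rcll (f : R -> R) : Prop :=
  (forall t : R, 0 <= t < T -> f x @[x --> t^'+] --> f t) /\
  (forall t : R, 0 < t <= T -> cvg (f x @[x --> t^'-])).

Definition L2T : set (Omega -> R) :=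
  [set xi | measurable_wrt (filtration T) xi /\
            (\int[P]_w (`|xi w| ^+ 2)%:E < +oo)%E].

(** squared distance of L^2 *)
Definition sqdist (xi eta : Omega -> R) : \bar R :=
  (\int[P]_w (`|xi w - eta w| ^+ 2)%:E)%E.

Definition L2_interior (D : set (Omega -> R)) : set (Omega -> R) :=
  [set xi | L2T xi /\ exists2 e : R, 0 < e &
     forall eta, L2T eta -> (sqdist eta xi < (e ^+ 2)%:E)%E -> D eta].

Definition L2_closed (D : set (Omega -> R)) : Prop :=
  forall xi, L2T xi ->
  (forall e : R, 0 < e -> exists2 eta, D eta & (sqdist eta xi < (e ^+ 2)%:E)%E) ->
  D xi.

(** Elementary integrand: the finite sum of h_k 1_{]a_k, b_k]}, where the
    intervals are allowed to overlap. *)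
Record elementary := Elementary {
  el_size : nat;
  el_lo : 'I_el_size -> R;
  el_hi : 'I_el_size -> R;
  el_coef : 'I_el_size -> Omega -> 'rV[R]_d }.

Definition elementary_wf (h : elementary) : Prop := forall k : 'I_(el_size h),
  [/\ 0 <= el_lo k, el_lo k <= el_hi k, el_hi k <= T,
      forall i, measurable_wrt (filtration (el_lo k)) (fun w => el_coef k w 0 i)
    & exists K : R, forall w, enorm (el_coef k w) <= K].

Definition elementary_process (h : elementary) (t : R) (w : Omega) : 'rV[R]_d :=
  \sum_(k < el_size h) (el_lo k < t <= el_hi k)%R%:R *: el_coef k w.

Definition elementary_integral (h : elementary) (t : R) (w : Omega) : R :=
  \sum_(k < el_size h) \sum_(i < d) el_coef k w 0 i *
    (W (Num.min (el_hi k) t) w 0 i - W (Num.min (el_lo k) t) w 0 i).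

Definition E_int_sq (z : R -> Omega -> 'rV[R]_d) : \bar R :=
  (\int[P]_w \int[lebesgue_measure]_(s in `[0%R, T]) (enorm (z s w) ^+ 2)%:E)%E.

(** [M] is a continuous version of t |-> \int_0^t z_s^* dW_s, the integral being
    obtained from elementary integrands by L^2 approximation. *)
Definition ito_integral (z : R -> Omega -> 'rV[R]_d) (M : R -> Omega -> R) : Prop :=
  [/\ adapted M,
      {ae P, forall w, {within `[0, T], continuous (fun t => M t w)}}
    & exists h : nat -> elementary,
      [/\ forall n, elementary_wf (h n),
          E_int_sq (fun t w => z t w - elementary_process (h n) t w)
            @[n --> \oo] --> 0%E
        & forall t : R, 0 <= t <= T ->
          sqdist (M t) (elementary_integral (h n) t) @[n --> \oo] --> 0%E]].

(** Standing assumptions on a coefficient [f] ([g] or [phi]), M being the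
    Lipschitz constant *)
Record coefficient (M : R) (f : Omega -> R -> R -> 'rV[R]_d -> R) : Prop := {
  coef_predictable : forall y z, predictable (fun t w => f w t y z);
  coef_convex : forall w (t : R), 0 <= t <= T -> forall (l y1 y2 : R) (z1 z2 : 'rV[R]_d),
    0 <= l <= 1 ->
    f w t (l * y1 + (1 - l) * y2) (l *: z1 + (1 - l) *: z2) <=
    l * f w t y1 z1 + (1 - l) * f w t y2 z2;
  coef_lipschitz : forall w (t : R), 0 <= t <= T -> forall (y1 y2 : R) (z1 z2 : 'rV[R]_d),
    `|f w t y1 z1 - f w t y2 z2| <= M * (`|y1 - y2| + enorm (z1 - z2));
  coef_vanish : forall w (t : R), 0 <= t <= T -> forall y : R, f w t y 0 = 0 }.

Context (g phi : Omega -> R -> R -> 'rV[R]_d -> R).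

Record supersolution (xi : Omega -> R)
    (y : R -> Omega -> R) (z : R -> Omega -> 'rV[R]_d) (C : R -> Omega -> R) :
    Prop := {
  ss_y_adapted : adapted y;
  ss_y_rcll : {ae P, forall w, rcll (y ^~ w)};
  ss_y_sup : (\int[P]_w ereal_sup [set (`|y t w| ^+ 2)%:E | t in `[0%R, T]] < +oo)%E;
  ss_z_predictable : forall i, predictable (fun t w => z t w 0 i);
  ss_z_sq : (E_int_sq z < +oo)%E;
  ss_C_adapted : adapted C;
  ss_C_rcll : {ae P, forall w, rcll (C ^~ w)};
  ss_C_incr : {ae P, forall w, forall s t : R,
    0 <= s -> s <= t -> t <= T -> C s w <= C t w};
  ss_C_start : {ae P, forall w, C 0 w = 0};
  ss_C_sq : (\int[P]_w (`|C T w| ^+ 2)%:E < +oo)%E;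
  ss_equation : exists2 Z, ito_integral z Z &
    {ae P, forall w, forall t : R, 0 <= t <= T ->
      y t w = xi w + \int[lebesgue_measure]_(s in `[t, T]) g w s (y s w) (z s w)
              - (Z T w - Z t w) + (C T w - C t w)} }.

(** a.e. on [0, T] x Omega, for dt (x) dP *)
Definition ae_time (Q : R -> Omega -> Prop) : Prop :=
  {ae (lebesgue_measure \x P)%E, forall p : R * Omega,
     0 <= p.1 <= T -> Q p.1 p.2}.

(** H^phi(xi) *)
Definition constrained_supersolutions (xi : Omega -> R) :
    set ((R -> Omega -> R) * (R -> Omega -> 'rV[R]_d) * (R -> Omega -> R)) :=
  [set s | supersolution xi s.1.1 s.1.2 s.2 /\
           ae_time (fun t w => phi w t (s.1.1 t w) (s.1.2 t w) = 0)].

(** [y] is the first component of a minimal element of H^phi(xi). *)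
Definition gGamma_solution (xi : Omega -> R) (y : R -> Omega -> R) : Prop :=
  exists z C, constrained_supersolutions xi (y, z, C) /\
    forall y' z' C', constrained_supersolutions xi (y', z', C') ->
      ae_time (fun t w => y t w <= y' t w).

(** The process E_t^{g,phi}(xi).  The minimal element is unique up to
    indistinguishability, and one is selected.  If there is none the value
    is +oo: for coefficients as above and xi in L^2_T this is the case exactly
    when H^phi(xi) is empty (existence theorem for the minimal element). *)
Definition gGamma_value (xi : Omega -> R) : R -> Omega -> \bar R :=
  xget (fun _ _ => +oo%E)
    [set (fun t w => (y t w)%:E) | y in gGamma_solution xi].

(** E_0(xi) is F_0-measurable, hence a.s. constant. *)
Definition gGamma_domain : set (Omega -> R) :=
  [set xi | L2T xi /\ {ae P, forall w, (-oo < gGamma_value xi 0 w < +oo)%E}].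

End processes.

(* Main.v *)
Require Import Defs.
From HB Require Import structures.
From mathcomp Require Import all_boot all_order all_algebra.
From mathcomp Require Import all_classical all_reals all_analysis.
From mathcomp Require Import measurable_realfun ring lra.
Import Order.TTheory GRing.Theory Num.Theory.
Import numFieldNormedType.Exports.
Set Implicit Arguments.
Unset Strict Implicit.
Unset Printing Implicit Defensive.
Local Open Scope classical_set_scope.
Local Open Scope ring_scope.

(** The value xi |-> E_t(xi) is a monotone convex map from random variables to
    random variables, and a monotone convex map is continuous at the interior
    points of its domain, by an argument that goes back to Namioka and Klee.

    Suppose that xi_n tends to xi in L^2 while infinitely many E_t(xi_n) stay
    away from E_t(xi).  Take a subsequence of these n, so fast that the sum of
    the 4^k E|xi_(n_k) - xi|^2 is small.  Then the single variable
      eta = (sum_k 4^k (xi_(n_k) - xi)^2)^(1/2)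
    has small L^2 norm and satisfies |xi_(n_k) - xi| <= 2^-k eta
    ([L2_dominating_variable]); in particular xi + eta is still in the domain.
    With a = 2^-k,
      xi_(n_k) <= (1 - a) xi + a (xi + eta)   and
      xi <= 1/(1+a) xi_(n_k) + a/(1+a) (xi + eta).
    Monotonicity and convexity turn these into
      |E_t(xi_(n_k)) - E_t(xi)| <= a (E_t(xi + eta) - E_t(xi))
    ([gGamma_solution_dist_le]), whose right-hand side tends to 0 in L^2, a
    contradiction.

    Monotonicity and convexity come from minimality, through one
    inequality ([minimal_le_conv]): if zeta <= l xi1 + (1-l) xi2, then the
    minimal super-solution with terminal value zeta lies below l y1 + (1-l) y2
    for all constrained super-solutions y1, y2 with terminal values xi1, xi2.
    To see it, one exhibits a constrained super-solution with terminal value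
    zeta and first component l y1 + (1-l) y2 on [0, T[ :
    - convexity of g makes l g(y1,z1) + (1-l) g(y2,z2) - g(y,z) nonnegative at
      the convex combination (y,z), so that its running integral can be added
      to the increasing process ([supersolution_conv]);
    - a terminal value is lowered by a jump of the increasing process at T
      ([supersolution_lower]);
    - convexity and nonnegativity of phi preserve phi = 0.
    Minimality is an inequality for almost every (t, omega); right-continuity
    of the paths upgrades it to every t ([ae_time_le_rcll]).

    Most of the work is measurability.  The running integral must be adapted,
    which is Tonelli's theorem for the sigma-algebra F_t, applied to integrands
    that are jointly measurable for B([0, t]) (x) F_t ([progressive]). *)

(** * Sampling right-continuous functions on finite grids *)

Section grid.
Context (R : realType).
(** The truncation at [t] keeps a process sampled on the grid measurable with
    respect to the information at time [t]. *)
Definition grid (t : R) (n k : nat) : R := Num.min t (k.+1%:R / n.+1%:R).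

Lemma grid_itv t n k : 0 <= t -> 0 <= grid t n k <= t.
Proof. by move=> t0; rewrite le_min t0/= divr_ge0//= ge_min lexx. Qed.

Lemma grid_trunc t n : grid t n (Num.truncn (t * n.+1%:R)) = t.
Proof. by apply/min_idPl; rewrite ler_pdivlMr//; apply/ltW/truncnS_gt. Qed.

(** The grid point just after [s] is strictly larger than [s] and within
    1/(n+1) of it. *)
Lemma cvg_grid (t s l : R) (f : R -> R) : 0 <= s < t -> f u @[u --> s^'+] --> l ->
  f (grid t n (Num.truncn (s * n.+1%:R))) @[n --> \oo] --> l.
Proof.
move=> /andP[s0 st] /cvg_at_rightP; apply; split=> [n|].
  by rewrite lt_min st/= ltr_pdivlMr//; exact: truncnS_gt.
apply: (@squeeze_cvgr _ _ _ _ (fun=> s) (fun n => s + n.+1%:R^-1)).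
- near=> n; rewrite /grid le_min (ltW st)/= ge_min ler_pdivlMr// ltW ?truncnS_gt//=.
  apply/orP; right; rewrite ler_pdivrMr// mulrDl mulVf ?gt_eqF//.
  by rewrite -natr1 lerD2r truncn_le mulr_ge0.
- exact: cvg_cst.
- rewrite -[X in _ --> X]addr0; apply: cvgD; first exact: cvg_cst.
  exact: cvg_harmonic.
Unshelve. all: by end_near. Qed.
End grid.

(** * The augmented Brownian filtration and progressive measurability *)

Section filtration.
Context (R : realType) (disp : measure_display) (Omega : measurableType disp).
Context (P : probability Omega R) (d : nat) (W : R -> Omega -> 'rV[R]_d).
Hypothesis P_complete : measure_is_complete P.
Hypothesis W_measurable :
  forall (t : R) i, 0 <= t -> measurable_fun setT (fun w => W t w 0 i).

(** Omega as a measurable space for F_t, so that the theory of measurable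
    functions and Tonelli's theorem apply to adapted processes. *)
Definition Omega_at (t : R) := g_sigma_algebraType (natural_sigma W t `|` P.-negligible).

Lemma measurable_wrtP t (X : Omega -> R) :
  measurable_wrt (filtration P W t) X <-> measurable_fun setT (X : Omega_at t -> R).
Proof.
split=> [mX _ B mB|mX B mB]; first by rewrite setTI; exact: mX.
by have := mX measurableT B mB; rewrite setTI.
Qed.

Lemma natural_sigma_mono s t : s <= t -> natural_sigma W s `<=` natural_sigma W t.
Proof.
move=> st; apply: smallest_sub; first exact: smallest_sigma_algebra.
move=> A [u [i [B [/andP[u0 us] mB AE]]]]; apply: sub_sigma_algebra.
by exists u, i, B; split=> //; rewrite u0 (le_trans us).
Qed.

Lemma filtration_mono s t : s <= t -> filtration P W s `<=` filtration P W t.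
Proof.
move=> st; apply: smallest_sub; first exact: smallest_sigma_algebra.
move=> A [sA|NA]; apply: sub_sigma_algebra; last by right.
by left; exact: natural_sigma_mono sA.
Qed.

(** Completeness of P is what makes the null sets added to F_t measurable. *)
Lemma filtration_measurable t : filtration P W t `<=` measurable.
Proof.
apply: smallest_sub; first exact: sigma_algebra_measurable.
move=> A [|]; last exact: P_complete.
apply: smallest_sub; first exact: sigma_algebra_measurable.
move=> {}A [u [i [B [/andP[u0 _] mB ->]]]].
by rewrite -[X in measurable X]setTI; exact: W_measurable.
Qed.

Lemma measurable_wrt_measurable t (X : Omega -> R) :
  measurable_wrt (filtration P W t) X -> measurable_fun setT X.
Proof.
move=> mX _ B mB; rewrite setTI; apply: (@filtration_measurable t).
exact: mX.
Qed.

Lemma measurable_wrt_mono s t (X : Omega -> R) : s <= t ->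
  measurable_wrt (filtration P W s) X -> measurable_wrt (filtration P W t) X.
Proof. by move=> st mX B mB; apply: (filtration_mono st); exact: mX. Qed.

(** The augmentation is used here: F_t contains the set where X and Y differ
    and all of its subsets. *)
Lemma measurable_wrt_ae t (X Y : Omega -> R) :
  measurable_wrt (filtration P W t) X -> {ae P, forall w, X w = Y w} ->
  measurable_wrt (filtration P W t) Y.
Proof.
move=> mX XY B mB.
have mneg (N : set Omega) : P.-negligible N -> measurable (N : set (Omega_at t)).
  by move=> N0; apply: sub_sigma_algebra; right.
have -> : Y @^-1` B = (X @^-1` B `\` [set w | X w <> Y w])
    `|` (Y @^-1` B `&` [set w | X w <> Y w]).
  apply/seteqP; split=> w /=.
    move=> BY; have [e|] := pselect (X w = Y w); last by right.
    by left; split=> //; rewrite /preimage/= e.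
  by move=> [[BX /contrapT <-]|[]].
apply: (@measurableU _ (Omega_at t) (X @^-1` B `\` [set w | X w <> Y w])).
  by apply: (@measurableD _ (Omega_at t)); [exact: mX|exact: mneg XY].
by apply: mneg; apply: negligibleS XY => w [].
Qed.

Definition progressive (t : R) (X : R -> Omega -> R) :=
  measurable_fun (`[0, t] `*` setT) (fun p : R * Omega_at t => X p.1 p.2).

Lemma eq_progressive t (X Y : R -> Omega -> R) :
  (forall s w, X s w = Y s w) -> progressive t X -> progressive t Y.
Proof. by move=> XY; congr progressive; apply/funext => s; apply/funext => w. Qed.

Lemma measurable_cylinder t :
  measurable (`[0, t] `*` [set: Omega_at t] : set (R * Omega_at t)).
Proof. exact: measurableX. Qed.

(** On [0, t] a generator ]s, u] x A with A in F_s is empty if s >= t, and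
    otherwise A belongs to F_t. *)
Lemma predictable_progressive T t X : 0 <= t -> t <= T ->
  predictable P W T X -> progressive t X.
Proof.
move=> t0 tT pX _ B mB.
have key (D : set (R * Omega)) : predictable_sets P W T D ->
    measurable ((`[0, t] `*` [set: Omega_at t]) `&` D : set (R * Omega_at t)).
  apply: (smallest_sub (C := sigma_algebra ([set` `[0, T]] `*` setT))
    (X := [set D |
      measurable ((`[0, t] `*` [set: Omega_at t]) `&` D : set (R * Omega_at t))])).
    split=> /=; first by rewrite setI0.
    - move=> A mA; rewrite (_ : _ `&` _ =
        (`[0, t] `*` [set: Omega_at t]) `\` ((`[0, t] `*` [set: Omega_at t]) `&` A)).
        by apply: measurableD => //; exact: measurable_cylinder.
      apply/seteqP; split=> [[s w]|[s w]] /=.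
        by move=> [[s0t _] [_ nA]]; split=> // -[].
      move=> [[s0t _] nA]; split=> //; split=> [|Asw]; last exact: nA.
      by split=> //; move: s0t; rewrite !in_itv/= => /andP[-> st]; exact: le_trans tT.
    - by move=> A mA; rewrite setI_bigcupr; exact: bigcupT_measurable.
  move=> {}D [[A FA <-]|[s [u [A [s0 su uT FA ->]]]]] /=.
    apply: measurableI; first exact: measurable_cylinder.
    by apply: measurableX => //; exact: (filtration_mono t0).
  have [st|ts] := leP s t.
    apply: measurableI; first exact: measurable_cylinder.
    by apply: measurableX => //; exact: (filtration_mono st).
  rewrite (_ : _ `&` _ = set0)//; apply/seteqP; split=> -[r w]//= [[r0t _] [rsu _]].
  move: r0t rsu; rewrite !in_itv/= => /andP[_ rt] /andP[sr _].
  by have := lt_le_trans (lt_trans ts sr) rt; rewrite ltxx.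
have := key _ (pX B mB); congr measurable; apply/seteqP; split=> -[s w] /=.
  by move=> [s0t [_ Bw]].
move=> [[s0t _] Bw]; do 2?split=> //.
by move: s0t; rewrite in_itv/= => /andP[-> st]; exact: le_trans tT.
Qed.

End filtration.

Section selection.
Context d (T : measurableType d) (R : realType).

(** Measurability of a countably-valued choice [c] among measurable functions;
    all limits of discretized processes below rest on it. *)
Lemma measurable_fun_select (K : countType) (D : set T) (c : T -> K)
    (f : K -> T -> R) :
  measurable D -> (forall k, measurable (D `&` c @^-1` [set k])) ->
  (forall k, measurable_fun D (f k)) -> measurable_fun D (fun x => f (c x) x).
Proof.
move=> mD mc mf _ B mB.
rewrite (_ : _ `&` _ =
  \bigcup_(k : K) ((D `&` c @^-1` [set k]) `&` (D `&` f k @^-1` B))).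
  by apply: countable_bigcupT_measurable => // k; apply: measurableI => //; exact: mf.
apply/seteqP; split=> x /=.
  by move=> [Dx Bx]; exists (c x).
by move=> [k _ [[_ <-] [Dx Bx]]].
Qed.

Lemma measurable_fun_floor_fiber (D : set T) (f : T -> R) (m : int) :
  measurable D -> measurable_fun D f ->
  measurable (D `&` (fun x => Num.floor (f x)) @^-1` [set m]).
Proof.
move=> mD mf; rewrite (_ : _ @^-1` _ = f @^-1` `[m%:~R, (m + 1)%:~R[).
  by apply: mf => //; exact: measurable_itv.
apply/seteqP; split=> x /=; rewrite in_itv/=.
  by move=> <-; exact: floor_itv.
by move=> h; exact: floor_def.
Qed.
End selection.

Lemma enorm_le_sum (R : realType) d (v : 'rV[R]_d) : enorm v <= \sum_i `|v 0 i|.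
Proof.
rewrite /enorm -[leRHS]ger0_norm ?sumr_ge0// -sqrtr_sqr ler_wsqrtr//.
rewrite expr2 mulr_sumr ler_sum// => i _.
rewrite -real_normK ?num_real// expr2 ler_wpM2r//.
by rewrite (bigD1 i)//= lerDl sumr_ge0.
Qed.

Section progressive.
Context (R : realType) (disp : measure_display) (Omega : measurableType disp).
Context (P : probability Omega R) (d : nat) (W : R -> Omega -> 'rV[R]_d).

(** The process sampled at the next grid point is progressive and, by
    right-continuity, converges to [y] as the grid is refined. *)
Lemma rcll_progressive t (y : R -> Omega -> R) :
  (forall s, 0 <= s <= t -> measurable_wrt (filtration P W t) (y s)) ->
  (forall w s, 0 <= s < t -> y u w @[u --> s^'+] --> y s w) ->
  progressive P W t y.
Proof.
move=> my cy; have n0 (n : nat) : 0 < n.+1%:R :> R by [].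
apply: (@measurable_fun_cvg _ (R * Omega_at P W t)%type R _
  (fun n (p : R * Omega_at P W t) => y (grid t n (Num.truncn (p.1 * n.+1%:R))) p.2)).
  move=> n; apply: (@measurable_fun_select _ (R * Omega_at P W t)%type R nat _
    (fun p => Num.truncn (p.1 * n.+1%:R)) (fun k p => y (grid t n k) p.2)).
  - exact: measurable_cylinder.
  - move=> k; rewrite (_ : _ `&` _ = (`[0, t] `*` [set: Omega_at P W t]) `&`
       (fst @^-1` `[k%:R / n.+1%:R, k.+1%:R / n.+1%:R[)).
      rewrite -[X in _ `&` X]setTI; apply: measurableI.
        exact: measurable_cylinder.
      by apply: measurable_fst => //; exact: measurable_itv.
    apply/seteqP; split=> -[s w] /= [[s0t _] h]; split=> //.
      have s0 : 0 <= s by move: s0t; rewrite in_itv/= => /andP[].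
      rewrite in_itv/= ler_pdivrMr// ltr_pdivlMr//.
      by rewrite -h; apply: truncn_itv; rewrite mulr_ge0.
    by apply: truncn_def; move: h; rewrite in_itv/= ler_pdivrMr// ltr_pdivlMr.
  move=> k; have [t0|t0] := leP 0 t.
    have mt : measurable_fun setT (y (grid t n k) : Omega_at P W t -> R).
      by apply/measurable_wrtP; apply: my; exact: grid_itv.
    apply: measurable_funS (measurableT_comp mt measurable_snd) => //.
  by rewrite set_itv_ge ?bnd_simp -?ltNge// set0X; exact: measurable_fun_set0.
move=> [s w] [/=]; rewrite in_itv/= => /andP[s0]; rewrite le_eqVlt.
move=> /predU1P[->|st] _.
  by under eq_fun do rewrite grid_trunc; exact: cvg_cst.
have s0t : 0 <= s < t by rewrite s0 st.
exact: (cvg_grid s0t (cy w s s0t)).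
Qed.

(** Rounding (y, z) down to a lattice of mesh 1/(n+1) leaves countably many
    values, for each of which the coefficient is predictable; the Lipschitz
    property makes the rounded compositions converge. *)
Lemma progressive_comp (T M t : R) (f : Omega -> R -> R -> 'rV[R]_d -> R)
    (y : R -> Omega -> R) (z : R -> Omega -> 'rV[R]_d) :
  0 <= t -> t <= T -> coefficient P W T M f -> progressive P W t y ->
  (forall i, progressive P W t (fun s w => z s w 0 i)) ->
  progressive P W t (fun s w => f w s (y s w) (z s w)).
Proof.
move=> t0 tT cf py pz.
pose q n (m : int) : R := m%:~R / n.+1%:R.
pose c n (p : R * Omega_at P W t) : int * 'rV[int]_d :=
  (Num.floor (y p.1 p.2 * n.+1%:R), \row_i Num.floor (z p.1 p.2 0 i * n.+1%:R)).
apply: (@measurable_fun_cvg _ (R * Omega_at P W t)%type R _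
  (fun n (p : R * Omega_at P W t) => f p.2 p.1 (q n (c n p).1) (map_mx (q n) (c n p).2))).
  move=> n; apply: (@measurable_fun_select _ (R * Omega_at P W t)%type R
    (int * 'rV[int]_d)%type _
    (c n) (fun k p => f p.2 p.1 (q n k.1) (map_mx (q n) k.2))).
  - exact: measurable_cylinder.
  - move=> [k1 k2]; rewrite (_ : _ `&` _ =
      ((`[0, t] `*` [set: Omega_at P W t]) `&`
        (fun p => Num.floor (y p.1 p.2 * n.+1%:R)) @^-1` [set k1]) `&`
      \bigcap_(i : 'I_d) ((`[0, t] `*` [set: Omega_at P W t]) `&`
        (fun p => Num.floor (z p.1 p.2 0 i * n.+1%:R)) @^-1` [set k2 0 i])).
      apply: measurableI.
        apply: measurable_fun_floor_fiber; first exact: measurable_cylinder.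
        by apply: measurable_funM => //; exact: measurable_cst.
      apply: fin_bigcap_measurable => // i _.
      apply: measurable_fun_floor_fiber; first exact: measurable_cylinder.
      by apply: measurable_funM; [exact: pz|exact: measurable_cst].
    apply/seteqP; split=> p /=.
      by rewrite /c => -[Dp [<- <-]]; split=> // i _; split=> //; rewrite mxE.
    move=> [[Dp e1] e2]; split=> //; rewrite /c e1; congr pair.
    by apply/rowP => i; rewrite mxE; have [] := e2 i I.
  - move=> k; apply: (@predictable_progressive _ _ _ _ _ _ T t
      (fun s w => f w s (q n k.1) (map_mx (q n) k.2))) => //.
    exact: (coef_predictable cf).
move=> [s w] [/=]; rewrite in_itv/= => /andP[s0 st] _.
have s0T : 0 <= s <= T by rewrite s0 (le_trans st).
have q_near n x : `|x - q n (Num.floor (x * n.+1%:R))| <= n.+1%:R^-1.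
  have n0 : 0 < n.+1%:R :> R by [].
  have /andP[h1 h2] := floor_itv (x * n.+1%:R).
  have hl : q n (Num.floor (x * n.+1%:R)) <= x by rewrite /q ler_pdivrMr.
  have hu : x < q n (Num.floor (x * n.+1%:R)) + n.+1%:R^-1.
    by rewrite /q -[X in _ + X]mul1r -mulrDl ltr_pdivlMr// -intrD1.
  by rewrite ger0_norm ?subr_ge0// lerBlDl ltW.
pose K := `|M| * (1 + d%:R).
have K0 : 0 < K + 1 by rewrite ltr_wpDl// mulr_ge0// addr_ge0.
apply/cvgrPdist_le => e e0; near=> n.
apply: (le_trans (coef_lipschitz cf w s0T _ _ _ _)).
apply: (@le_trans _ _ (`|M| * ((1 + d%:R) * n.+1%:R^-1))).
  apply: (@le_trans _ _ (`|M| * _)); first apply: ler_wpM2r (ler_norm M).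
    by apply: addr_ge0 => //; exact: sqrtr_ge0.
  apply: ler_wpM2l => //.
  rewrite mulrDl mul1r lerD//=.
  apply: (le_trans (enorm_le_sum _)).
  rewrite (_ : d%:R * n.+1%:R^-1 = \sum_(i < d) n.+1%:R^-1 :> R).
    by apply: ler_sum => i _; rewrite !mxE; exact: q_near.
  by rewrite sumr_const card_ord mulr_natl.
rewrite mulrA -/K.
apply: (@le_trans _ _ ((K + 1) * (e / (K + 1)))); last by rewrite mulrC divfK ?gt_eqF.
apply: ler_pM; rewrite ?mulr_ge0 ?addr_ge0 ?lerDl//.
near: n; apply: filterS (near_infty_natSinv_lt (PosNum (divr_gt0 e0 K0))) => n.
exact: ltW.
Unshelve. all: by end_near. Qed.

End progressive.

(** * Integral inequalities *)

Section integrals.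
Context d (T : measurableType d) (R : realType) (mu : {measure set T -> \bar R}).

Lemma ge0_integral_le_scaleD (D : set T) (c : R) (f f1 f2 : T -> \bar R) :
  measurable D -> 0 <= c ->
  measurable_fun D f -> measurable_fun D f1 -> measurable_fun D f2 ->
  (forall x, D x -> 0 <= f x)%E -> (forall x, D x -> 0 <= f1 x)%E ->
  (forall x, D x -> 0 <= f2 x)%E ->
  (forall x, D x -> f x <= c%:E * (f1 x + f2 x))%E ->
  (\int[mu]_(x in D) f x <=
    c%:E * (\int[mu]_(x in D) f1 x + \int[mu]_(x in D) f2 x))%E.
Proof.
move=> mD c0 mf mf1 mf2 f0 f10 f20 le_f.
rewrite -ge0_integralD// -ge0_integralZl//.
- apply: ge0_le_integral => //; apply: measurable_funeM; exact: emeasurable_funD.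
- exact: emeasurable_funD.
- by move=> x Dx; rewrite adde_ge0 ?f10 ?f20.
Qed.

Lemma sqr_integrable_integrable (D : set T) (f : T -> R) :
  measurable D -> (mu D < +oo)%E -> measurable_fun D f ->
  (\int[mu]_(x in D) (f x ^+ 2)%:E < +oo)%E -> mu.-integrable D (EFin \o f).
Proof.
move=> mD muD mf f2; apply/integrableP; split; first exact/measurable_EFinP.
apply: (@le_lt_trans _ _ (1%:E * (\int[mu]_(x in D) (f x ^+ 2)%:E +
  \int[mu]_(x in D) 1%:E))%E).
  apply: ge0_integral_le_scaleD => //.
  - by apply: measurableT_comp => //; exact/measurable_EFinP.
  - by apply/measurable_EFinP; exact: measurable_funX.
  - by move=> x _; rewrite lee_fin sqr_ge0.
  - move=> x _; rewrite mul1e -EFinD lee_fin.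
    have [h|h] := leP `|f x| 1; first by rewrite ler_wpDl ?sqr_ge0.
    by rewrite ler_wpDr// -real_normK ?num_real// expr2 ler_peMl// ltW.
by rewrite mul1e lte_add_pinfty// integral_cst// mul1e.
Qed.

(** Cauchy-Schwarz against the constant 1: integrate 2 m f <= m^2 + f^2 for the
    mean m of f over D. *)
Lemma sqr_integral_le (D : set T) (f : T -> R) :
  measurable D -> (mu D < +oo)%E -> measurable_fun D f ->
  (forall x, D x -> 0 <= f x) ->
  (\int[mu]_(x in D) (f x ^+ 2)%:E < +oo)%E ->
  (((\int[mu]_(x in D) f x) ^+ 2)%:E
    <= mu D * \int[mu]_(x in D) (f x ^+ 2)%:E)%E.
Proof.
move=> mD muD mf f0 f2.
have fi := sqr_integrable_integrable mD muD mf f2.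
have b0 : (0 <= \int[mu]_(x in D) (f x ^+ 2)%:E)%E.
  by apply: integral_ge0 => x _; rewrite lee_fin sqr_ge0.
have [mu0|mu0] := eqVneq (mu D) 0%E.
  rewrite mu0 mul0e /Rintegral.
  by rewrite null_set_integral//= ?expr0n//; exact/measurable_EFinP.
have muf : mu D \is a fin_num by rewrite ge0_fin_numE.
have m0 : 0 < fine (mu D) by rewrite fine_gt0// muD lt0e mu0 measure_ge0.
have bf : (\int[mu]_(x in D) (f x ^+ 2)%:E)%E \is a fin_num by rewrite ge0_fin_numE.
set A := \int[mu]_(x in D) f x.
have A0 : 0 <= A by apply: Rintegral_ge0.
set m := fine (mu D) in m0 *; set b := fine (\int[mu]_(x in D) (f x ^+ 2)%:E)%E.
rewrite -(fineK muf) -(fineK bf) -EFinM lee_fin -/m -/b.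
have : (\int[mu]_(x in D) ((2 * (A / m))%:E * (f x)%:E) <=
    1%:E * (\int[mu]_(x in D) ((A / m) ^+ 2)%:E + \int[mu]_(x in D) (f x ^+ 2)%:E))%E.
  apply: ge0_integral_le_scaleD => //.
  - by apply/measurable_EFinP; exact: measurable_funM.
  - by apply/measurable_EFinP; exact: measurable_funX.
  - by move=> x Dx; rewrite lee_fin mulr_ge0 ?f0// mulr_ge0// divr_ge0// ltW.
  - by move=> x Dx; rewrite lee_fin sqr_ge0.
  - by move=> x Dx; rewrite lee_fin sqr_ge0.
  - move=> x Dx; rewrite mul1e lee_fin -subr_ge0.
    by rewrite (_ : _ - _ = (A / m - f x) ^+ 2) ?sqr_ge0//; ring.
rewrite integralZl// mul1e integral_cst//.
rewrite -(fineK muf) -(fineK bf) -(fineK (integrable_fin_num mD fi)) -/b -/m -/A.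
rewrite lee_fin => h.
suff : A ^+ 2 / m <= b by rewrite ler_pdivrMr// mulrC.
have <- : 2 * (A / m) * A - (A / m) ^+ 2 * m = A ^+ 2 / m by field; rewrite gt_eqF.
by rewrite lerBlDl.
Qed.
End integrals.

(** * Processes with right-continuous paths *)

Section rcll_version.
Context (R : realType) (disp : measure_display) (Omega : measurableType disp).
Context (P : probability Omega R) (d : nat) (W : R -> Omega -> 'rV[R]_d) (T : R).
Hypothesis P_complete : measure_is_complete P.
Hypothesis W_measurable :
  forall (t : R) i, 0 <= t -> measurable_fun setT (fun w => W t w 0 i).
Hypothesis T_ge0 : 0 <= T.

(** Changing [y] to 0 on the exceptional null set keeps it adapted, since the
    filtration is augmented. *)
Lemma rcll_version (y : R -> Omega -> R) :
  adapted P W T y -> {ae P, forall w, rcll T (y ^~ w)} ->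
  exists y0 : R -> Omega -> R,
  [/\ adapted P W T y0, {ae P, forall w, forall s, y0 s w = y s w} &
      forall w, rcll T (y0 ^~ w)].
Proof.
move=> ay cy; pose y0 s w := if `[< rcll T (y ^~ w) >] then y s w else 0.
have y0E : {ae P, forall w, forall s, y0 s w = y s w}.
  by apply: filterS cy => w cw s; rewrite /y0; case: asboolP.
exists y0; split=> //.
  move=> t t0T; apply: (@measurable_wrt_ae _ _ _ _ _ _ _ (y t)); first exact: ay.
  by apply: filterS y0E => w.
move=> w; rewrite /y0; case: asboolP => // _.
by split=> t _ ; [exact: cvg_cst|apply/cvg_ex; exists 0; exact: cvg_cst].
Qed.

Lemma adapted_progressive t (y : R -> Omega -> R) : 0 <= t <= T ->
  adapted P W T y -> (forall w, rcll T (y ^~ w)) -> progressive P W t y.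
Proof.
move=> /andP[t0 tT] ay cy; apply: rcll_progressive.
  move=> s /andP[s0 st]; apply: (measurable_wrt_mono st).
  by apply: ay; rewrite s0 (le_trans st).
by move=> w s /andP[s0 st]; apply: (cy w).1; rewrite s0 (lt_le_trans st).
Qed.

(** By right-continuity the supremum over [0, T] is a supremum over the
    countably many grid points; [T] itself is one of them. *)
Lemma measurable_rcll_sup (y : R -> Omega -> R) :
  (forall s, 0 <= s <= T -> measurable_fun setT (y s)) ->
  (forall w, rcll T (y ^~ w)) ->
  measurable_fun setT
    (fun w => ereal_sup [set (`|y t w| ^+ 2)%:E | t in `[0%R, T]]).
Proof.
move=> my cy; pose e t w : \bar R := (`|y t w| ^+ 2)%:E.
pose u n w := e (if @choice.unpickle (nat * nat)%type n is Some k
  then grid T k.1 k.2 else T) w.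
rewrite (_ : (fun w => _) = fun w => esups (u ^~ w) 0%N).
  apply: measurable_fun_esups => n; rewrite /u /e; apply/measurable_EFinP.
  apply: measurable_funX; apply: measurableT_comp => //; apply: my.
  by case: unpickle => [k|]; [exact: grid_itv|rewrite T_ge0 lexx].
apply/funext => w; apply/eqP; rewrite eq_le; apply/andP; split.
  apply: ge_ereal_sup => x [s]; rewrite /= in_itv/= => /andP[s0 sT] <-.
  have uE n k : (e (grid T n k) w <= esups (u ^~ w) 0%N)%E.
    apply: ereal_sup_ubound; exists (choice.pickle (n, k)) => //.
    by rewrite /u choice.pickleK.
  move: sT; rewrite le_eqVlt => /predU1P[->|sT].
    by rewrite -(grid_trunc T 0); exact: uE.
  have s0T : 0 <= s < T by rewrite s0 sT.
  have es : e (grid T n (Num.truncn (s * n.+1%:R))) w @[n --> \oo] --> e s w.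
    apply: cvg_EFin; first by near=> n.
    apply: cvgM; apply: cvg_norm; exact: (cvg_grid s0T ((cy w).1 _ s0T)).
  rewrite -[X in (X <= _)%E]/(e s w); rewrite -(cvg_lim _ es)//.
  by apply: lime_le; [apply/cvg_ex; eexists; exact: es|near=> n].
apply: ge_ereal_sup => x [n _ <-]; apply: ereal_sup_ubound => /=.
rewrite /u; case: unpickle => [k|]; last by exists T => //=; rewrite in_itv/= T_ge0 lexx.
by exists (grid T k.1 k.2) => //=; rewrite in_itv/=; exact: grid_itv.
Unshelve. all: by end_near. Qed.
End rcll_version.

(** * Integrals over time and chance *)

Section occupation.
Context (R : realType) (disp : measure_display) (Omega : measurableType disp).
Context (P : probability Omega R) (d : nat) (W : R -> Omega -> 'rV[R]_d) (T : R).
Hypothesis P_complete : measure_is_complete P.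
Hypothesis W_measurable :
  forall (t : R) i, 0 <= t -> measurable_fun setT (fun w => W t w 0 i).

Lemma measurable_fun_Omega_at t d' (U : measurableType d') (Y : Omega -> U) :
  measurable_fun setT (Y : Omega_at P W t -> U) -> measurable_fun setT Y.
Proof.
move=> mY _ B mB; rewrite setTI.
apply: (filtration_measurable P_complete W_measurable (t := t)).
by have := mY measurableT B mB; rewrite setTI.
Qed.

Lemma progressive_section t (f : R -> Omega -> R) w :
  progressive P W t f -> measurable_fun `[0, t] (f ^~ w).
Proof.
move=> pf; rewrite (_ : f ^~ w = (fun p : R * Omega_at P W t => f p.1 p.2) \o
  (fun s => (s, w : Omega_at P W t)))//.
apply: measurable_comp pf _; first exact: measurable_cylinder.
  by move=> _ [s s0t <-].
by apply: measurable_funTS; exact: pair2_measurable.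
Qed.

(** Tonelli's theorem on R x (Omega, F_t). *)
Lemma progressive_integral t (f : R -> Omega -> R) :
  progressive P W t f -> (forall s w, 0 <= s <= t -> 0 <= f s w) ->
  measurable_fun setT
    ((fun w => \int[lebesgue_measure]_(s in `[0%R, t]) (f s w)%:E)%E
      : Omega_at P W t -> \bar R).
Proof.
move=> pf f0.
pose F := (fun p : R * Omega_at P W t => (f p.1 p.2)%:E)
  \_ (`[0, t] `*` [set: Omega_at P W t]).
have mF : measurable_fun [set: R * Omega_at P W t] F.
  have mf : measurable_fun (`[0, t] `*` setT)
      (fun p : R * Omega_at P W t => (f p.1 p.2)%:E).
    exact/measurable_EFinP.
  exact: (measurable_restrictT _ (@measurable_cylinder _ _ _ P _ W t)).1 mf.
have F0 p : (0 <= F p)%E.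
  rewrite /F patchE; case: ifPn => // /set_mem[/=]; rewrite in_itv/= => h _.
  by rewrite lee_fin f0.
have := @measurable_fun_fubini_tonelli_G _ _ _ _ R lebesgue_measure _ mF F0.
congr measurable_fun; apply/funext => w; rewrite /fubini_G [RHS]integral_mkcond.
apply: eq_integral => s _; rewrite /F !patchE.
by rewrite in_setX/= in_setT andbT.
Qed.

Definition occupation (f : R -> Omega -> R) : \bar R :=
  (\int[P]_w \int[lebesgue_measure]_(s in `[0%R, T]) (f s w)%:E)%E.

Lemma occupation_le_scaleD (c : R) (f f1 f2 : R -> Omega -> R) : 0 <= c ->
  progressive P W T f -> progressive P W T f1 -> progressive P W T f2 ->
  (forall s w, 0 <= s <= T -> 0 <= f s w) ->
  (forall s w, 0 <= s <= T -> 0 <= f1 s w) ->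
  (forall s w, 0 <= s <= T -> 0 <= f2 s w) ->
  (forall s w, 0 <= s <= T -> f s w <= c * (f1 s w + f2 s w)) ->
  (occupation f <= c%:E * (occupation f1 + occupation f2))%E.
Proof.
move=> c0 pf pf1 pf2 f0 f10 f20 le_f.
have itvE s : s \in `[0, T] -> 0 <= s <= T by rewrite in_itv.
apply: ge0_integral_le_scaleD => //.
1-3: by apply: measurable_fun_Omega_at; exact: progressive_integral.
- by move=> w _; apply: integral_ge0 => s /itvE h; rewrite lee_fin f0.
- by move=> w _; apply: integral_ge0 => s /itvE h; rewrite lee_fin f10.
- by move=> w _; apply: integral_ge0 => s /itvE h; rewrite lee_fin f20.
move=> w _; apply: ge0_integral_le_scaleD => //.
1-3: by apply/measurable_EFinP; exact: progressive_section.
- by move=> s /itvE h; rewrite lee_fin f0.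
- by move=> s /itvE h; rewrite lee_fin f10.
- by move=> s /itvE h; rewrite lee_fin f20.
- by move=> s /itvE h; rewrite -EFinD -EFinM lee_fin le_f.
Qed.

Lemma occupation_fin_integrable (f : R -> Omega -> R) :
  progressive P W T f -> (occupation (fun s w => f s w ^+ 2)%R < +oo)%E ->
  {ae P, forall w,
    (\int[lebesgue_measure]_(s in `[0%R, T]) (f s w ^+ 2)%:E < +oo)%E /\
    lebesgue_measure.-integrable `[0, T] (EFin \o f ^~ w)}.
Proof.
move=> pf f2.
have pf2 : progressive P W T (fun s w => f s w ^+ 2) by exact: measurable_funX.
have mf2 := measurable_fun_Omega_at (progressive_integral pf2 (fun s w _ => sqr_ge0 _)).
have ge0 w : (0 <= \int[lebesgue_measure]_(s in `[0%R, T]) (f s w ^+ 2)%:E)%E.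
  by apply: integral_ge0 => s _; rewrite lee_fin sqr_ge0.
have /integrable_ae : P.-integrable setT
    (fun w => \int[lebesgue_measure]_(s in `[0%R, T]) (f s w ^+ 2)%:E)%E.
  apply/integrableP; split=> //.
  by under eq_integral do rewrite gee0_abs//.
move=> /(_ measurableT); apply: filterS => w /(_ I) fw.
have fw2 : (\int[lebesgue_measure]_(s in `[0%R, T]) (f s w ^+ 2)%:E < +oo)%E.
  by rewrite ltey_eq fw.
split=> //; apply: sqr_integrable_integrable => //=.
  by rewrite lebesgue_measure_itv/=; case: ifP => _; rewrite ?ltry// -EFinB ltry.
exact: progressive_section.
Qed.
End occupation.

(** * Linearity of the stochastic integral *)

(** Cauchy-Schwarz in the plane; it gives all the L^2 bounds for linear
    combinations below with one constant. *)
Lemma sqr_lincomb_le (R : realType) (a b x y : R) :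
  (a * x + b * y) ^+ 2 <= (a ^+ 2 + b ^+ 2) * (x ^+ 2 + y ^+ 2).
Proof.
rewrite -subr_ge0 (_ : _ - _ = (a * y - b * x) ^+ 2) ?sqr_ge0//; ring.
Qed.

Lemma enorm_sqr (R : realType) d (v : 'rV[R]_d) : enorm v ^+ 2 = \sum_i v 0 i ^+ 2.
Proof. by rewrite /enorm sqr_sqrtr// sumr_ge0// => i _; rewrite sqr_ge0. Qed.

Lemma enorm_ge0 (R : realType) d (v : 'rV[R]_d) : 0 <= enorm v.
Proof. exact: sqrtr_ge0. Qed.

Lemma enorm_lincomb_le (R : realType) d (a b : R) (u v : 'rV[R]_d) :
  enorm (a *: u + b *: v) ^+ 2 <=
  (a ^+ 2 + b ^+ 2) * (enorm u ^+ 2 + enorm v ^+ 2).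
Proof.
rewrite !enorm_sqr -big_split/= mulr_sumr ler_sum// => i _.
by rewrite !mxE sqr_lincomb_le.
Qed.

Lemma cvge0_squeeze (R : realType) (c : R) (u v1 v2 : (\bar R)^nat) :
  (forall n, 0 <= u n)%E -> (forall n, u n <= c%:E * (v1 n + v2 n))%E ->
  v1 @ \oo --> 0%E -> v2 @ \oo --> 0%E -> u @ \oo --> 0%E.
Proof.
move=> u0 uv v10 v20.
apply: (@squeeze_cvge _ _ _ _ (fun=> 0%E) _ (fun n => c%:E * (v1 n + v2 n))%E).
- by near=> n; rewrite u0 uv.
- exact: cvg_cst.
- rewrite -(mule0 c%:E) -[X in (_ * X)%E](adde0 0%E).
  by apply: cvgeZl => //; apply: cvgeD.
Unshelve. all: by end_near. Qed.

Lemma E_sqr_lincomb_le d (T : measurableType d) (R : realType)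
    (mu : {measure set T -> \bar R}) (a b : R) (X Y : T -> R) :
  measurable_fun setT X -> measurable_fun setT Y ->
  (\int[mu]_w (`|a * X w + b * Y w| ^+ 2)%:E <= (a ^+ 2 + b ^+ 2)%:E *
    (\int[mu]_w (`|X w| ^+ 2)%:E + \int[mu]_w (`|Y w| ^+ 2)%:E))%E.
Proof.
move=> mX mY.
have msq (Z : T -> R) : measurable_fun setT Z ->
    measurable_fun setT (fun w => (`|Z w| ^+ 2)%:E).
  by move=> mZ; apply/measurable_EFinP; apply: measurable_funX; exact: measurableT_comp.
apply: ge0_integral_le_scaleD => //; try (by move=> w _; rewrite lee_fin sqr_ge0).
- by rewrite addr_ge0 ?sqr_ge0.
- by apply: msq; apply: measurable_funD; exact: measurable_funM.
- exact: msq.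
- exact: msq.
- by move=> w _; rewrite -EFinD -EFinM lee_fin !real_normK ?num_real// sqr_lincomb_le.
Qed.

Section elementary.
Context (R : realType) (disp : measure_display) (Omega : measurableType disp).
Context (P : probability Omega R) (d : nat) (W : R -> Omega -> 'rV[R]_d) (T : R).
Hypothesis P_complete : measure_is_complete P.
Hypothesis W_measurable :
  forall (t : R) i, 0 <= t -> measurable_fun setT (fun w => W t w 0 i).
Hypothesis T_ge0 : 0 <= T.

(** Intervals of an elementary integrand may overlap, so a sum is just a
    concatenation. *)
Definition elementary_lincomb (a b : R) (h1 h2 : elementary R Omega d) :
    elementary R Omega d :=
  @Elementary R disp Omega d (el_size h1 + el_size h2)
    (fun k => match fintype.split k with inl i => el_lo i | inr i => el_lo i end)
    (fun k => match fintype.split k with inl i => el_hi i | inr i => el_hi i end)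
    (fun k => match fintype.split k with inl i => fun w => a *: el_coef i w
                               | inr i => fun w => b *: el_coef i w end).

Lemma elementary_process_lincomb a b h1 h2 t w :
  elementary_process (elementary_lincomb a b h1 h2) t w =
  a *: elementary_process h1 t w + b *: elementary_process h2 t w.
Proof.
rewrite /elementary_process big_split_ord/= !scaler_sumr.
congr (_ + _); apply: eq_bigr => i _.
  by rewrite (unsplitK (inl _)) !scalerA mulrC.
by rewrite (unsplitK (inr _)) !scalerA mulrC.
Qed.

Lemma elementary_integral_lincomb a b h1 h2 t w :
  elementary_integral W (elementary_lincomb a b h1 h2) t w =
  a * elementary_integral W h1 t w + b * elementary_integral W h2 t w.
Proof.
rewrite /elementary_integral big_split_ord/= !mulr_sumr.
congr (_ + _); apply: eq_bigr => k _; rewrite mulr_sumr; apply: eq_bigr => i _.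
  by rewrite (unsplitK (inl _)) mxE mulrA.
by rewrite (unsplitK (inr _)) mxE mulrA.
Qed.

Lemma measurable_wrt_lincomb t (a b : R) (X Y : Omega -> R) :
  measurable_wrt (filtration P W t) X -> measurable_wrt (filtration P W t) Y ->
  measurable_wrt (filtration P W t) (fun w => a * X w + b * Y w).
Proof.
move=> /measurable_wrtP mX /measurable_wrtP mY; apply/measurable_wrtP.
by apply: measurable_funD; apply: measurable_funM => //; exact: measurable_cst.
Qed.

Lemma elementary_wf_lincomb a b (h1 h2 : elementary R Omega d) :
  elementary_wf P W T h1 -> elementary_wf P W T h2 ->
  elementary_wf P W T (elementary_lincomb a b h1 h2).
Proof.
have scaled c (h : elementary R Omega d) (k : 'I_(el_size h)) :
    (forall i, measurable_wrt (filtration P W (el_lo k)) (fun w => el_coef k w 0 i)) ->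
    (exists K : R, forall w, enorm (el_coef k w) <= K) ->
    (forall i, measurable_wrt (filtration P W (el_lo k))
      (fun w => (c *: el_coef k w) 0 i)) /\
    (exists K : R, forall w, enorm (c *: el_coef k w) <= K).
  move=> mk [K hK]; split.
    move=> i; rewrite (_ : (fun w => _) =
        fun w => c * el_coef k w 0 i + 0 * el_coef k w 0 i).
      exact: measurable_wrt_lincomb.
    by apply/funext => w; rewrite mxE mul0r addr0.
  exists (`|c| * K) => w.
  have K0 : 0 <= K by exact: le_trans (enorm_ge0 _) (hK w).
  rewrite -ler_sqr ?nnegrE ?enorm_ge0 ?mulr_ge0//.
  rewrite enorm_sqr exprMn real_normK ?num_real//.
  under eq_bigr do rewrite mxE exprMn.
  by rewrite -mulr_sumr -enorm_sqr ler_wpM2l ?sqr_ge0// ler_sqr ?nnegrE ?enorm_ge0.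
move=> wf1 wf2 k; rewrite /elementary_lincomb/=; case: (fintype.split k) => i.
  by have [? ? ? mi bi] := wf1 i; have [] := scaled a _ _ mi bi; split.
by have [? ? ? mi bi] := wf2 i; have [] := scaled b _ _ mi bi; split.
Qed.

Lemma elementary_process_progressive h i : elementary_wf P W T h ->
  progressive P W T (fun t w => elementary_process h t w 0 i).
Proof.
move=> wf; rewrite /progressive (_ : (fun p : R * Omega_at P W T => _) = fun p =>
    \sum_(k < el_size h) (el_lo k < p.1 <= el_hi k)%R%:R * el_coef k p.2 0 i); last first.
  by apply/funext => p; rewrite summxE; apply: eq_bigr => k _; rewrite mxE.
apply: measurable_sum => k; have [lo0 lohi hiT mk _] := wf k.
apply: measurable_funM.
  rewrite (_ : (fun p : R * Omega_at P W T => _) =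
     (\1_(`]el_lo k, el_hi k]) : R -> R) \o (fst : R * Omega_at P W T -> R)).
    apply: measurable_funTS; apply: measurableT_comp => //.
  by apply/funext => p; rewrite /= indicE mem_setE in_itv.
have mkT : measurable_fun setT ((fun w => el_coef k w 0 i) : Omega_at P W T -> R).
  apply/measurable_wrtP; apply: measurable_wrt_mono (mk i); exact: le_trans hiT.
apply: measurable_funTS; exact: (measurableT_comp mkT measurable_snd).
Qed.

Lemma measurable_elementary_integral h t : elementary_wf P W T h -> 0 <= t ->
  measurable_fun setT (elementary_integral W h t).
Proof.
move=> wf t0; rewrite /elementary_integral.
apply: measurable_sum => k; have [lo0 lohi hiT mk _] := wf k.
apply: measurable_sum => i; apply: measurable_funM.
  exact: (measurable_wrt_measurable P_complete W_measurable (mk i)).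
by apply: measurable_funB; apply: W_measurable; rewrite le_min t0 andbT// (le_trans lo0).
Qed.

Lemma enorm_sqr_progressive (z : R -> Omega -> 'rV[R]_d) :
  (forall i, progressive P W T (fun t w => z t w 0 i)) ->
  progressive P W T (fun t w => enorm (z t w) ^+ 2).
Proof.
move=> pz; apply: (@eq_progressive _ _ _ _ _ _ _ (fun t w => \sum_i z t w 0 i ^+ 2)).
  by move=> t w; rewrite enorm_sqr.
by apply: measurable_sum => i; apply: measurable_funX; exact: pz.
Qed.

Lemma progressive_lincomb (a b : R) (f1 f2 : R -> Omega -> R) :
  progressive P W T f1 -> progressive P W T f2 ->
  progressive P W T (fun t w => a * f1 t w + b * f2 t w).
Proof.
move=> p1 p2; apply: measurable_funD; apply: measurable_funM => //;
  exact: measurable_cst.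
Qed.

Lemma E_int_sq_lincomb_le (a b : R) (z1 z2 : R -> Omega -> 'rV[R]_d) :
  (forall i, progressive P W T (fun t w => z1 t w 0 i)) ->
  (forall i, progressive P W T (fun t w => z2 t w 0 i)) ->
  (E_int_sq P T (fun t w => a *: z1 t w + b *: z2 t w)%R <=
    (a ^+ 2 + b ^+ 2)%:E * (E_int_sq P T z1 + E_int_sq P T z2))%E.
Proof.
move=> p1 p2; apply: (occupation_le_scaleD P_complete W_measurable).
- by rewrite addr_ge0 ?sqr_ge0.
- apply: enorm_sqr_progressive => i.
  apply: eq_progressive (progressive_lincomb a b (p1 i) (p2 i)) => s w.
  by rewrite !mxE.
- exact: enorm_sqr_progressive.
- exact: enorm_sqr_progressive.
- by move=> *; exact: sqr_ge0.
- by move=> *; exact: sqr_ge0.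
- by move=> *; exact: sqr_ge0.
- by move=> *; exact: enorm_lincomb_le.
Qed.

Lemma adapted_lincomb (a b : R) (X Y : R -> Omega -> R) :
  adapted P W T X -> adapted P W T Y ->
  adapted P W T (fun t w => a * X t w + b * Y t w).
Proof. by move=> aX aY t t0T; apply: measurable_wrt_lincomb; [exact: aX|exact: aY]. Qed.

(** The linear combinations of two approximating sequences approximate the
    linear combination, for the integrands and for the integrals alike. *)
Lemma ito_integral_lincomb (a b : R) (z1 z2 : R -> Omega -> 'rV[R]_d)
    (M1 M2 : R -> Omega -> R) :
  (forall i, progressive P W T (fun t w => z1 t w 0 i)) ->
  (forall i, progressive P W T (fun t w => z2 t w 0 i)) ->
  ito_integral P W T z1 M1 -> ito_integral P W T z2 M2 ->
  ito_integral P W T (fun t w => a *: z1 t w + b *: z2 t w)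
    (fun t w => a * M1 t w + b * M2 t w).
Proof.
move=> p1 p2 [aM1 cM1 [h1 [wf1 E1 I1]]] [aM2 cM2 [h2 [wf2 E2 I2]]].
have pB (z : R -> Omega -> 'rV[R]_d) h :
    (forall i, progressive P W T (fun t w => z t w 0 i)) ->
    elementary_wf P W T h ->
    forall i, progressive P W T (fun t w => (z t w - elementary_process h t w) 0 i).
  move=> pz wf i.
  apply: (@eq_progressive _ _ _ _ _ _ _
    (fun t w => z t w 0 i - elementary_process h t w 0 i)) => [s w|].
    by rewrite !mxE.
  by apply: measurable_funB; [exact: pz|exact: elementary_process_progressive].
split; first exact: adapted_lincomb.
  apply: filterS2 cM1 cM2 => w c1 c2 t.
  by apply: cvgD; apply: cvgM; [exact: cvg_cst|exact: c1|exact: cvg_cst|exact: c2].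
exists (fun n => elementary_lincomb a b (h1 n) (h2 n)); split.
- by move=> n; exact: elementary_wf_lincomb.
- apply: cvge0_squeeze E1 E2 => n.
    by apply: integral_ge0 => w _; apply: integral_ge0 => s _; rewrite lee_fin sqr_ge0.
  apply: le_trans (E_int_sq_lincomb_le a b (pB _ _ p1 (wf1 n)) (pB _ _ p2 (wf2 n))).
  rewrite le_eqVlt; apply/orP; left; apply/eqP; congr E_int_sq.
  apply/funext => t; apply/funext => w; rewrite elementary_process_lincomb.
  by rewrite !scalerBr opprD addrACA.
move=> t t0T; have /andP[t0 _] := t0T.
apply: cvge0_squeeze (I1 t t0T) (I2 t t0T) => n.
  by apply: integral_ge0 => w _; rewrite lee_fin sqr_ge0.
have mB M h : adapted P W T M -> elementary_wf P W T h ->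
    measurable_fun setT (fun w => M t w - elementary_integral W h t w).
  move=> aM wf; apply: measurable_funB; last exact: measurable_elementary_integral.
  exact: (measurable_wrt_measurable P_complete W_measurable (aM t t0T)).
apply: le_trans (E_sqr_lincomb_le P a b (mB _ _ aM1 (wf1 n)) (mB _ _ aM2 (wf2 n))).
rewrite le_eqVlt; apply/orP; left; apply/eqP.
apply: eq_integral => w _; rewrite elementary_integral_lincomb.
by congr (`|_| ^+ 2)%:E; ring.
Qed.
End elementary.

(** * Running integrals and drivers *)

Section running_integral.
Context (R : realType) (T : R) (f : R -> R).
Hypothesis T_gt0 : 0 < T.
Hypothesis f_int : lebesgue_measure.-integrable `[0, T] (EFin \o f).
Notation F := (fun t => \int[lebesgue_measure]_(s in `[0, t]) f s).

Lemma subitv_integrable a b : 0 <= a -> b <= T ->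
  lebesgue_measure.-integrable `[a, b] (EFin \o f).
Proof.
move=> a0 bT; apply: integrableS f_int => //.
by apply: subset_itv; rewrite bnd_simp.
Qed.

Lemma running_integralB s t : 0 <= s -> s <= t -> t <= T ->
  F t - F s = \int[lebesgue_measure]_(u in `[s, t]) f u.
Proof.
move=> s0 st tT; rewrite Rintegral_itvB ?bnd_simp//; last exact: subitv_integrable.
apply: Rintegral_itv_obnd_cbnd; apply: integrableS (subitv_integrable s0 tT) => //.
by apply: subset_itv; rewrite bnd_simp.
Qed.

Lemma rcll_running_integral : rcll T F.
Proof.
have := parameterized_integral_continuous (ltW T_gt0) f_int.
rewrite /parameterized_integral => /(continuous_within_itvP _ T_gt0)[cF c0 cT].
have cF' t : 0 < t < T -> F x @[x --> t] --> F t.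
  by move=> t0T; apply: cF; rewrite in_itv.
split=> t /andP[].
  rewrite le_eqVlt => /predU1P[<- _|t0 tT]; first exact: c0.
  by apply: cvg_at_right_filter; apply: cF'; rewrite t0.
move=> t0; rewrite le_eqVlt => /predU1P[->|tT].
  by apply/cvg_ex; exists (F T).
apply/cvg_ex; exists (F t).
by apply: cvg_at_left_filter; apply: cF'; rewrite t0.
Qed.

Lemma ge0_running_integral_le s t : (forall u, 0 <= u <= T -> 0 <= f u) ->
  0 <= s -> s <= t -> t <= T -> F s <= F t.
Proof.
move=> f0 s0 st tT; rewrite -subr_ge0 running_integralB//.
apply: Rintegral_ge0 => u /=; rewrite in_itv/= => /andP[su ut].
by apply: f0; rewrite (le_trans s0)//= (le_trans ut).
Qed.
End running_integral.

Lemma rcll_lincomb (R : realType) (T a b : R) (f1 f2 : R -> R) :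
  rcll T f1 -> rcll T f2 -> rcll T (fun t => a * f1 t + b * f2 t).
Proof.
move=> [r1 l1] [r2 l2]; split=> t t0T.
  by apply: cvgD; apply: cvgM; [exact: cvg_cst|exact: r1|exact: cvg_cst|exact: r2].
by apply: is_cvgD; apply: is_cvgM;
  [exact: is_cvg_cst|exact: l1|exact: is_cvg_cst|exact: l2].
Qed.

Lemma scaleD_lty (R : realType) (c : R) (x y : \bar R) :
  0 <= c -> (x < +oo -> y < +oo -> c%:E * (x + y) < +oo)%E.
Proof. by move=> c0 x_lty y_lty; rewrite lte_mul_pinfty ?lee_fin// lte_add_pinfty. Qed.

Lemma integral_sqr_lincomb_lty d (T : measurableType d) (R : realType)
    (mu : {measure set T -> \bar R}) (a b : R) (X Y : T -> R) :
  measurable_fun setT X -> measurable_fun setT Y ->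
  (\int[mu]_w (`|X w| ^+ 2)%:E < +oo)%E -> (\int[mu]_w (`|Y w| ^+ 2)%:E < +oo)%E ->
  (\int[mu]_w (`|a * X w + b * Y w| ^+ 2)%:E < +oo)%E.
Proof.
move=> mX mY X2 Y2; apply: le_lt_trans (E_sqr_lincomb_le mu a b mX mY) _.
by apply: scaleD_lty => //; rewrite addr_ge0 ?sqr_ge0.
Qed.

Section supersolutions.
Context (R : realType) (disp : measure_display) (Omega : measurableType disp).
Context (P : probability Omega R) (d : nat) (W : R -> Omega -> 'rV[R]_d) (T : R).
Context (g : Omega -> R -> R -> 'rV[R]_d -> R) (M : R).
Hypothesis P_complete : measure_is_complete P.
Hypothesis W_measurable :
  forall (t : R) i, 0 <= t -> measurable_fun setT (fun w => W t w 0 i).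
Hypothesis T_gt0 : 0 < T.
Hypothesis g_coef : coefficient P W T M g.
Let T_ge0 : 0 <= T := ltW T_gt0.
Implicit Types (y : R -> Omega -> R) (z : R -> Omega -> 'rV[R]_d).

Lemma measurable_sup_sqr (y : R -> Omega -> R) :
  adapted P W T y -> {ae P, forall w, rcll T (y ^~ w)} ->
  measurable_fun setT
    (fun w => ereal_sup [set (`|y t w| ^+ 2)%:E | t in `[0%R, T]]).
Proof.
move=> ay cy; have [y0 [ay0 y0E cy0]] := rcll_version ay cy.
apply: (ae_measurable_fun P_complete (f := fun w =>
   ereal_sup [set (`|y0 t w| ^+ 2)%:E | t in `[0%R, T]])); last first.
  apply: measurable_rcll_sup => // s s0T.
  exact: (measurable_wrt_measurable P_complete W_measurable (ay0 s s0T)).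
apply: filterS y0E => w y0E _.
by congr ereal_sup; apply: eq_imagel => t _; rewrite y0E.
Qed.

Lemma sup_sqr_lty_at (y : R -> Omega -> R) t : 0 <= t <= T ->
  adapted P W T y -> {ae P, forall w, rcll T (y ^~ w)} ->
  (\int[P]_w ereal_sup [set (`|y t w| ^+ 2)%:E | t in `[0%R, T]] < +oo)%E ->
  (\int[P]_w (`|y t w| ^+ 2)%:E < +oo)%E.
Proof.
move=> t0T ay cy; apply: le_lt_trans; apply: ge0_le_integral => //.
- apply/measurable_EFinP; apply: measurable_funX; apply: measurableT_comp => //.
  exact: (measurable_wrt_measurable P_complete W_measurable (ay t t0T)).
- exact: measurable_sup_sqr.
- by move=> w _; apply: ereal_sup_ubound; exists t.
Qed.

Definition driver (y : R -> Omega -> R) (z : R -> Omega -> 'rV[R]_d) s w :=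
  g w s (y s w) (z s w).

Lemma driver_progressive y z t : 0 <= t <= T ->
  adapted P W T y -> (forall w, rcll T (y ^~ w)) ->
  (forall i, predictable P W T (fun s w => z s w 0 i)) ->
  progressive P W t (driver y z).
Proof.
move=> t0T ay cy pz; have /andP[t0 tT] := t0T.
apply: progressive_comp g_coef _ _ => //; first exact: adapted_progressive cy.
by move=> i; apply: predictable_progressive (pz i).
Qed.

(** From the Lipschitz property and g(., y, 0) = 0.  It makes the driver square
    integrable without any bound on [y]. *)
Lemma driver_bound y z s w : 0 <= s <= T -> `|driver y z s w| <= M * enorm (z s w).
Proof.
move=> s0T; rewrite -[X in `|X|]subr0 -(coef_vanish g_coef w s0T (y s w)).
apply: le_trans (coef_lipschitz g_coef w s0T _ _ _ _) _.
by rewrite subrr normr0 add0r subr0.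
Qed.

Lemma occupation_sqr_driver_lty y z :
  adapted P W T y -> (forall w, rcll T (y ^~ w)) ->
  (forall i, predictable P W T (fun s w => z s w 0 i)) ->
  (E_int_sq P T z < +oo)%E ->
  (occupation P T (fun s w => driver y z s w ^+ 2)%R < +oo)%E.
Proof.
move=> ay cy pz z2; have TT : 0 <= T <= T by rewrite T_ge0 lexx.
have pz2 : progressive P W T (fun s w => enorm (z s w) ^+ 2).
  by apply: enorm_sqr_progressive => i; apply: predictable_progressive (pz i).
apply: (@le_lt_trans _ _ ((M ^+ 2)%:E * (E_int_sq P T z + E_int_sq P T z))%E).
  apply: (occupation_le_scaleD P_complete W_measurable) => //.
  - exact: sqr_ge0.
  - by apply: measurable_funX; exact: driver_progressive.
  - by move=> *; exact: sqr_ge0.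
  - by move=> *; exact: sqr_ge0.
  - by move=> *; exact: sqr_ge0.
  move=> s w s0T; apply: (@le_trans _ _ (M ^+ 2 * enorm (z s w) ^+ 2)).
    rewrite -exprMn -real_normK ?num_real// ler_sqr ?nnegrE//.
      exact: driver_bound.
    by apply: le_trans (driver_bound y z w s0T).
  by rewrite ler_wpM2l ?sqr_ge0// lerDl sqr_ge0.
by apply: scaleD_lty => //; exact: sqr_ge0.
Qed.

Lemma occupation_sqr_lincomb_lty (a b : R) (f1 f2 : R -> Omega -> R) :
  progressive P W T f1 -> progressive P W T f2 ->
  (occupation P T (fun s w => f1 s w ^+ 2)%R < +oo)%E ->
  (occupation P T (fun s w => f2 s w ^+ 2)%R < +oo)%E ->
  (occupation P T (fun s w => (a * f1 s w + b * f2 s w) ^+ 2)%R < +oo)%E.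
Proof.
move=> p1 p2 o1 o2.
apply: (@le_lt_trans _ _ ((a ^+ 2 + b ^+ 2)%:E *
    (occupation P T (fun s w => f1 s w ^+ 2)%R +
     occupation P T (fun s w => f2 s w ^+ 2)%R))%E).
  apply: (occupation_le_scaleD P_complete W_measurable).
  - by rewrite addr_ge0 ?sqr_ge0.
  - by apply: measurable_funX; exact: progressive_lincomb.
  - by apply: measurable_funX.
  - by apply: measurable_funX.
  - by move=> *; exact: sqr_ge0.
  - by move=> *; exact: sqr_ge0.
  - by move=> *; exact: sqr_ge0.
  - by move=> *; exact: sqr_lincomb_le.
by apply: scaleD_lty => //; rewrite addr_ge0 ?sqr_ge0.
Qed.

(** This is what makes the increasing process of a convex combination
    adapted. *)
Lemma running_integral_adapted (k : R -> Omega -> R) :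
  (forall t, 0 <= t <= T -> progressive P W t k) ->
  (forall s w, 0 <= s <= T -> 0 <= k s w) ->
  adapted P W T (fun t w => \int[lebesgue_measure]_(s in `[0, t]) k s w).
Proof.
move=> pk k0 t t0T; apply/measurable_wrtP.
have /andP[_ tT] := t0T.
have kt0 s w : 0 <= s <= t -> 0 <= k s w.
  by move=> /andP[s0 st]; apply: k0; rewrite s0 (le_trans st).
rewrite /Rintegral; exact: measurableT_comp (progressive_integral (pk t t0T) kt0).
Qed.

Lemma running_integral_sqr_lty (k : R -> Omega -> R) :
  progressive P W T k -> (forall s w, 0 <= s <= T -> 0 <= k s w) ->
  (occupation P T (fun s w => k s w ^+ 2)%R < +oo)%E ->
  measurable_fun setT (fun w => \int[lebesgue_measure]_(s in `[0, T]) k s w) ->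
  (\int[P]_w (`|\int[lebesgue_measure]_(s in `[0, T]) k s w| ^+ 2)%:E < +oo)%E.
Proof.
move=> pk k0 k2 mK.
have pk2 : progressive P W T (fun s w => k s w ^+ 2) by exact: measurable_funX.
have mk2 := measurable_fun_Omega_at P_complete W_measurable
  (progressive_integral pk2 (fun s w _ => sqr_ge0 _)).
have muT : lebesgue_measure (`[0, T] : set R) = T%:E.
  by rewrite lebesgue_measure_itv/= lte_fin T_gt0 sube0.
have ge0 w : (0 <= \int[lebesgue_measure]_(s in `[0%R, T]) (k s w ^+ 2)%:E)%E.
  by apply: integral_ge0 => s _; rewrite lee_fin sqr_ge0.
apply: (@le_lt_trans _ _ (T%:E * occupation P T (fun s w => k s w ^+ 2)%R)%E); last first.
  by rewrite lte_mul_pinfty// lee_fin.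
rewrite -ge0_integralZl//.
apply: ge0_le_integral => //.
- by apply/measurable_EFinP; apply: measurable_funX; exact: measurableT_comp.
- exact: measurable_funeM.
move=> w _; rewrite real_normK ?num_real//.
have [kw|] := ltP (\int[lebesgue_measure]_(s in `[0%R, T]) (k s w ^+ 2)%:E)%E +oo%E.
  rewrite -muT; apply: sqr_integral_le => //=.
  - by rewrite muT ltry.
  - exact: progressive_section pk.
  - by move=> s; rewrite in_itv/= => s0T; exact: k0.
by rewrite leye_eq => /eqP ->; rewrite gt0_muley ?leey// lte_fin.
Qed.

End supersolutions.

(** * Convex combinations of super-solutions *)

Section convexity.
Context (R : realType) (disp : measure_display) (Omega : measurableType disp).
Context (P : probability Omega R) (d : nat) (W : R -> Omega -> 'rV[R]_d) (T : R).
Context (g : Omega -> R -> R -> 'rV[R]_d -> R) (M : R).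
Hypothesis P_complete : measure_is_complete P.
Hypothesis W_measurable :
  forall (t : R) i, 0 <= t -> measurable_fun setT (fun w => W t w 0 i).
Hypothesis T_gt0 : 0 < T.
Hypothesis g_coef : coefficient P W T M g.
Let T_ge0 : 0 <= T := ltW T_gt0.
Implicit Types (y C : R -> Omega -> R) (z : R -> Omega -> 'rV[R]_d).

Let Pred := g_sigma_algebraType (predictable_sets P W T).
Let strip : set (R * Omega) := [set` `[0, T]] `*` setT.

(** [predictable_sets] is a sigma-algebra on the strip [0, T] x Omega only; it is
    the trace there of the sigma-algebra it generates on R x Omega. *)
Lemma predictableP (X : R -> Omega -> R) :
  predictable P W T X <->
  measurable_fun (strip : set Pred) ((fun p => X p.1 p.2) : Pred -> R).
Proof.
have [S0 SD SU] : sigma_algebra strip (predictable_sets P W T).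
  exact: smallest_sigma_algebra.
have SI A : predictable_sets P W T A -> predictable_sets P W T (strip `&` A).
  by move=> SA; rewrite -setDD; apply: (SD); apply: (SD).
have SS A : <<s predictable_sets P W T>> A -> predictable_sets P W T (strip `&` A).
  apply: (smallest_sub (X := [set A | predictable_sets P W T (strip `&` A)])) => //.
  split=> /=; first by rewrite setI0.
  - move=> B SB; rewrite setTD -setDE (_ : strip `\` B = strip `\` (strip `&` B)).
      exact: SD.
    by rewrite setDIr setDv set0U.
  - by move=> B SB; rewrite setI_bigcupr; exact: SU.
have stripE B : strip `&` (fun p => X p.1 p.2) @^-1` B =
    [set p | 0 <= p.1 <= T /\ B (X p.1 p.2)].
  apply/seteqP; split=> p; rewrite /strip/= in_itv/=; first by move=> [[]].
  by move=> [].
split=> [pX _ B mB|mX B mB].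
  rewrite stripE; apply: sub_sigma_algebra; apply: (pX B mB).
suff : predictable_sets P W T (strip `&` (fun p => X p.1 p.2) @^-1` B).
  by rewrite stripE.
have mstrip : measurable (strip : set Pred).
  by apply: sub_sigma_algebra; rewrite -[X in _ X]setD0; exact: SD.
by have := SS _ (mX mstrip B mB); rewrite setIA setIid.
Qed.

Lemma predictable_lincomb (a b : R) (X Y : R -> Omega -> R) :
  predictable P W T X -> predictable P W T Y ->
  predictable P W T (fun t w => a * X t w + b * Y t w).
Proof.
move=> /predictableP mX /predictableP mY; apply/predictableP.
by apply: measurable_funD; apply: measurable_funM => //; exact: measurable_cst.
Qed.

(** The stochastic integrals combine linearly, while by convexity the drivers
    leave the nonnegative defect k = l g(y1,z1) + (1-l) g(y2,z2) - g(y,z); its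
    running integral is increasing and joins the convex combination of C1 and
    C2. *)
Lemma supersolution_conv (l : R) xi1 xi2 y1 y2 z1 z2 C1 C2 : 0 <= l <= 1 ->
  supersolution P W T g xi1 y1 z1 C1 -> supersolution P W T g xi2 y2 z2 C2 ->
  exists C, supersolution P W T g (fun w => l * xi1 w + (1 - l) * xi2 w)
    (fun t w => l * y1 t w + (1 - l) * y2 t w)
    (fun t w => l *: z1 t w + (1 - l) *: z2 t w) C.
Proof.
move=> l01 [ay1 cy1 sy1 pz1 sz1 aC1 cC1 iC1 C10 sC1 [Z1 iZ1 eq1]]
           [ay2 cy2 sy2 pz2 sz2 aC2 cC2 iC2 C20 sC2 [Z2 iZ2 eq2]].
have TT : 0 <= T <= T by rewrite T_ge0 lexx.
have [v1 [av1 v1E cv1]] := rcll_version ay1 cy1.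
have [v2 [av2 v2E cv2]] := rcll_version ay2 cy2.
pose v t w := l * v1 t w + (1 - l) * v2 t w.
pose z t w := l *: z1 t w + (1 - l) *: z2 t w.
have av : adapted P W T v by exact: adapted_lincomb.
have cv w : rcll T (v ^~ w) by exact: rcll_lincomb.
have pz i : predictable P W T (fun t w => z t w 0 i).
  rewrite (_ : (fun t w => _) =
      fun t w => l * z1 t w 0 i + (1 - l) * z2 t w 0 i).
    exact: predictable_lincomb.
  by apply/funext => t; apply/funext => w; rewrite !mxE.
have gz1 i : progressive P W T (fun t w => z1 t w 0 i).
  exact: predictable_progressive (pz1 i).
have gz2 i : progressive P W T (fun t w => z2 t w 0 i).
  exact: predictable_progressive (pz2 i).
have sz : (E_int_sq P T z < +oo)%E.
  apply: le_lt_trans (E_int_sq_lincomb_le P_complete W_measurable l (1 - l) gz1 gz2) _.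
  by apply: scaleD_lty => //; rewrite addr_ge0 ?sqr_ge0.
pose G1 := driver g v1 z1; pose G2 := driver g v2 z2; pose G := driver g v z.
pose k s w := l * G1 s w + (1 - l) * G2 s w - G s w.
pose K t w := \int[lebesgue_measure]_(s in `[0, t]) k s w.
have pG1 t (t0T : 0 <= t <= T) : progressive P W t G1.
  exact: (driver_progressive g_coef t0T av1 cv1 pz1).
have pG2 t (t0T : 0 <= t <= T) : progressive P W t G2.
  exact: (driver_progressive g_coef t0T av2 cv2 pz2).
have pG t (t0T : 0 <= t <= T) : progressive P W t G.
  exact: (driver_progressive g_coef t0T av cv pz).
have oG1 := occupation_sqr_driver_lty P_complete W_measurable T_gt0 g_coef
  av1 cv1 pz1 sz1.
have oG2 := occupation_sqr_driver_lty P_complete W_measurable T_gt0 g_coef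
  av2 cv2 pz2 sz2.
have oG := occupation_sqr_driver_lty P_complete W_measurable T_gt0 g_coef
  av cv pz sz.
have pG12 t (t0T : 0 <= t <= T) :
    progressive P W t (fun s w => l * G1 s w + (1 - l) * G2 s w).
  exact: progressive_lincomb (pG1 t t0T) (pG2 t t0T).
have pk t (t0T : 0 <= t <= T) : progressive P W t k.
  by apply: measurable_funB; [exact: pG12|exact: pG].
have k0 s w : 0 <= s <= T -> 0 <= k s w.
  by move=> s0T; rewrite subr_ge0; exact: (coef_convex g_coef).
have ok : (occupation P T (fun s w => k s w ^+ 2)%R < +oo)%E.
  have := occupation_sqr_lincomb_lty P_complete W_measurable 1 (- 1)
    (pG12 T TT) (pG T TT)
    (occupation_sqr_lincomb_lty P_complete W_measurable l (1 - l)
      (pG1 T TT) (pG2 T TT) oG1 oG2) oG.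
  congr (occupation _ _ _ < _)%E; apply/funext => s; apply/funext => w.
  by rewrite mul1r mulN1r.
have intG1 := occupation_fin_integrable P_complete W_measurable (pG1 T TT) oG1.
have intG2 := occupation_fin_integrable P_complete W_measurable (pG2 T TT) oG2.
have intG := occupation_fin_integrable P_complete W_measurable (pG T TT) oG.
have intk := occupation_fin_integrable P_complete W_measurable (pk T TT) ok.
have aK : adapted P W T K by exact: running_integral_adapted.
have mt y t : 0 <= t <= T -> adapted P W T y -> measurable_fun setT (y t).
  move=> t0T ay; exact: (measurable_wrt_measurable P_complete W_measurable (ay t t0T)).
pose C12 t w := l * C1 t w + (1 - l) * C2 t w.
have aC12 : adapted P W T C12 by exact: adapted_lincomb.
(* The factors 1 let the lemmas on linear combinations apply to C12 + K. *)
exists (fun t w => 1 * C12 t w + 1 * K t w); split.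
- exact: adapted_lincomb.
- by apply: filterS2 cy1 cy2 => w; exact: rcll_lincomb.
- apply: (@le_lt_trans _ _ ((l ^+ 2 + (1 - l) ^+ 2)%:E *
    (\int[P]_w ereal_sup [set (`|y1 t w| ^+ 2)%:E | t in `[0%R, T]] +
     \int[P]_w ereal_sup [set (`|y2 t w| ^+ 2)%:E | t in `[0%R, T]]))%E); last first.
    by apply: scaleD_lty => //; rewrite addr_ge0 ?sqr_ge0.
  have sup_ge0 y w :
      (0 <= ereal_sup [set (`|y t w| ^+ 2)%:E | t in `[0%R, T]])%E.
    apply: (@le_trans _ _ (`|y 0 w| ^+ 2)%:E); first by rewrite lee_fin sqr_ge0.
    by apply: ereal_sup_ubound; exists 0 => //=; rewrite in_itv/= lexx.
  apply: ge0_integral_le_scaleD => //.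
  + by rewrite addr_ge0 ?sqr_ge0.
  + apply: (measurable_sup_sqr P_complete W_measurable T_gt0).
      exact: adapted_lincomb.
    by apply: filterS2 cy1 cy2 => w; exact: rcll_lincomb.
  + exact: (measurable_sup_sqr P_complete W_measurable T_gt0).
  + exact: (measurable_sup_sqr P_complete W_measurable T_gt0).
  + by move=> w _; exact: (sup_ge0 (fun t w => l * y1 t w + (1 - l) * y2 t w)).
  + move=> w _; apply: ge_ereal_sup => x [t t0T <-].
    apply: (@le_trans _ _ ((l ^+ 2 + (1 - l) ^+ 2)%:E *
      ((`|y1 t w| ^+ 2)%:E + (`|y2 t w| ^+ 2)%:E))%E).
      by rewrite -EFinD -EFinM lee_fin !real_normK ?num_real// sqr_lincomb_le.
    apply: lee_wpmul2l; first by rewrite lee_fin addr_ge0 ?sqr_ge0.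
    by apply: leeD; apply: ereal_sup_ubound; exists t.
- exact: pz.
- exact: sz.
- exact: adapted_lincomb.
- apply: filterS3 cC1 cC2 intk => w r1 r2 [_ ik].
  by apply: rcll_lincomb; [exact: rcll_lincomb|exact: rcll_running_integral].
- apply: filterS3 iC1 iC2 intk => w i1 i2 [_ ik] s t s0 st tT.
  have [l0 l1] := andP l01.
  rewrite !mul1r lerD//.
    by rewrite lerD// ler_wpM2l ?subr_ge0// ?i1 ?i2.
  by apply: ge0_running_integral_le tT => // u; exact: k0.
- apply: filterS2 C10 C20 => w e1 e2.
  by rewrite /C12 e1 e2 /K set_itv1 Rintegral_set1; ring.
- apply: integral_sqr_lincomb_lty => //; [exact: mt|exact: mt| |].
    by apply: integral_sqr_lincomb_lty => //; exact: mt.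
  by apply: (running_integral_sqr_lty P_complete W_measurable T_gt0) => //;
    [exact: pk|exact: (mt K T TT aK)].
exists (fun t w => l * Z1 t w + (1 - l) * Z2 t w).
  exact: ito_integral_lincomb.
apply: filterS3 (filterI eq1 intG1) (filterI eq2 intG2)
  (filterI (filterI v1E v2E) (filterI intG intk)).
move=> w [q1 [_ i1]] [q2 [_ i2]] [[e1 e2] [[_ iG] [_ ik]]].
move=> t t0T; have /andP[t0 tT] := t0T.
have GE (y : R -> Omega -> R) (u : R -> Omega -> R) zz :
    (forall s, u s w = y s w) ->
    \int[lebesgue_measure]_(s in `[t, T]) g w s (y s w) (zz s w) =
    \int[lebesgue_measure]_(s in `[t, T]) driver g u zz s w.
  by move=> uy; apply: eq_Rintegral => s _; rewrite /driver uy.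
rewrite (q1 t t0T) (q2 t t0T) (GE _ _ _ e1) (GE _ _ _ e2).
have -> : \int[lebesgue_measure]_(s in `[t, T])
      g w s (l * y1 s w + (1 - l) * y2 s w) (l *: z1 s w + (1 - l) *: z2 s w) =
    \int[lebesgue_measure]_(s in `[t, T]) G s w.
  by apply: eq_Rintegral => s _; rewrite /G /driver /v e1 e2.
have kE : K T w - K t w =
    l * \int[lebesgue_measure]_(s in `[t, T]) G1 s w +
    (1 - l) * \int[lebesgue_measure]_(s in `[t, T]) G2 s w -
    \int[lebesgue_measure]_(s in `[t, T]) G s w.
  have j1 := subitv_integrable i1 t0 (lexx T).
  have j2 := subitv_integrable i2 t0 (lexx T).
  have j := subitv_integrable iG t0 (lexx T).
  have cj (c : R) f : lebesgue_measure.-integrable `[t, T] (EFin \o f) ->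
      lebesgue_measure.-integrable `[t, T] (EFin \o (fun s => c * f s)).
    by move=> jf; apply: (integrableZl _ c jf).
  rewrite (running_integralB ik) // RintegralB//; last first.
    by apply: (integrableD _ (cj l _ j1) (cj (1 - l) _ j2)).
  by rewrite RintegralD ?RintegralZl//; exact: cj.
transitivity (l * xi1 w + (1 - l) * xi2 w +
  \int[lebesgue_measure]_(s in `[t, T]) G s w -
  (l * Z1 T w + (1 - l) * Z2 T w - (l * Z1 t w + (1 - l) * Z2 t w)) +
  (C12 T w - C12 t w + (K T w - K t w))); last by rewrite /C12; ring.
by rewrite kE /C12 -/G1 -/G2; ring.
Qed.
End convexity.

(** * Lowering the terminal value *)

Lemma rcll_update_end (R : realType) (T c : R) (f : R -> R) :
  rcll T f -> rcll T (fun t => if t == T then c else f t).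
Proof.
move=> [rf lf]; split=> t /andP[t0 tT].
  rewrite lt_eqF//; apply: cvg_trans (rf t _); last by rewrite t0.
  apply: near_eq_cvg; near=> x; rewrite lt_eqF//; near: x.
have t0T : 0 < t <= T by rewrite t0.
have /cvg_ex[b fb] := lf t t0T.
apply/cvg_ex; exists b; apply: cvg_trans fb.
apply: near_eq_cvg; near=> x; rewrite lt_eqF//; apply: lt_le_trans tT; near: x.
exact: nbhs_left_lt.
Unshelve. all: by end_near. Qed.

Lemma eq_Rintegral_but_end (R : realType) (t T : R) (f f' : R -> R) :
  measurable_fun `[t, T] f -> (forall s, s < T -> f' s = f s) ->
  \int[lebesgue_measure]_(s in `[t, T]) f' s =
  \int[lebesgue_measure]_(s in `[t, T]) f s.
Proof.
move=> mf ff'; congr fine.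
have mfo : measurable_fun `[t, T[ (EFin \o f).
  apply/measurable_EFinP; apply: measurable_funS mf => //.
  by apply: subset_itv; rewrite bnd_simp.
have ffo : {in `[t, T[%classic, EFin \o f =1 EFin \o f'}.
  by move=> s; rewrite inE/= in_itv/= => /andP[_ sT]; rewrite ff'.
rewrite -!integral_itv_bndo_bndc//; last exact: eq_measurable_fun mfo.
by apply: eq_integral => s /ffo.
Qed.

Section lowering.
Context (R : realType) (disp : measure_display) (Omega : measurableType disp).
Context (P : probability Omega R) (d : nat) (W : R -> Omega -> 'rV[R]_d) (T : R).
Context (g : Omega -> R -> R -> 'rV[R]_d -> R) (M : R).
Hypothesis P_complete : measure_is_complete P.
Hypothesis W_measurable :
  forall (t : R) i, 0 <= t -> measurable_fun setT (fun w => W t w 0 i).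
Hypothesis T_gt0 : 0 < T.
Hypothesis g_coef : coefficient P W T M g.
Let T_ge0 : 0 <= T := ltW T_gt0.
Implicit Types (y C : R -> Omega -> R) (z : R -> Omega -> 'rV[R]_d).

(** The equation at time T, where all its integrals and increments vanish. *)
Lemma supersolution_end xi y z C : supersolution P W T g xi y z C ->
  {ae P, forall w, y T w = xi w}.
Proof.
move=> s; have [Z _] := ss_equation s; apply: filterS => w /(_ T).
rewrite T_ge0 lexx => /(_ isT) ->.
by rewrite set_itv1 Rintegral_set1; ring.
Qed.

(** The new increasing process jumps at T by the amount of the lowering; that
    amount is square integrable because the old terminal value is [y T].  The
    driver integrals do not see the single time T. *)
Lemma supersolution_lower xi zeta y z C : supersolution P W T g xi y z C ->
  L2T P W T zeta -> {ae P, forall w, zeta w <= xi w} ->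
  exists C', supersolution P W T g zeta
    (fun t w => if t == T then zeta w else y t w) z C'.
Proof.
move=> s [mzeta zeta2] zeta_le.
have yT := supersolution_end s.
have [ay cy sy pz sz aC cC iC C0 sC [Z iZ eqy]] := s.
have TT : 0 <= T <= T by rewrite T_ge0 lexx.
have mt (X : R -> Omega -> R) t : 0 <= t <= T -> adapted P W T X ->
    measurable_fun setT (X t).
  move=> t0T aX; exact: (measurable_wrt_measurable P_complete W_measurable (aX t t0T)).
have mze : measurable_fun setT zeta.
  exact: (measurable_wrt_measurable P_complete W_measurable mzeta).
(* The height y_T - zeta of the jump; y_T, unlike xi, is known to be square
   integrable. *)
pose J w := 1 * y T w + (- 1) * zeta w.
have a_y' : adapted P W T (fun t w => if t == T then zeta w else y t w).
  by move=> t t0T; case: eqP => [->|_] //; exact: ay.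
have c_y' : {ae P, forall w, rcll T (fun t => if t == T then zeta w else y t w)}.
  by apply: filterS cy => w; exact: rcll_update_end.
exists (fun t w => if t == T then 1 * C T w + 1 * J w else C t w); split=> //.
- apply: (@le_lt_trans _ _ (1%:E *
    (\int[P]_w ereal_sup [set (`|y t w| ^+ 2)%:E | t in `[0%R, T]] +
     \int[P]_w (`|zeta w| ^+ 2)%:E))%E); last exact: scaleD_lty.
  have sup_ge0 y' w :
      (0 <= ereal_sup [set (`|y' t w| ^+ 2)%:E | t in `[0%R, T]])%E.
    apply: (@le_trans _ _ (`|y' 0 w| ^+ 2)%:E); first by rewrite lee_fin sqr_ge0.
    by apply: ereal_sup_ubound; exists 0 => //=; rewrite in_itv/= lexx.
  apply: ge0_integral_le_scaleD => //.
  + exact: (measurable_sup_sqr P_complete W_measurable T_gt0).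
  + exact: (measurable_sup_sqr P_complete W_measurable T_gt0).
  + by apply/measurable_EFinP; apply: measurable_funX; exact: measurableT_comp.
  + by move=> w _; exact: (sup_ge0 (fun t w => if t == T then zeta w else y t w)).
  + move=> w _; rewrite mul1e; apply: ge_ereal_sup => x [t t0T <-].
    case: eqP => _; first by rewrite leeDr.
    rewrite -[leLHS]adde0; apply: leeD; last by rewrite lee_fin sqr_ge0.
    by apply: ereal_sup_ubound; exists t.
- move=> t t0T; have [->|_] := eqVneq t T; last exact: aC.
  apply: measurable_wrt_lincomb; first exact: aC.
  by apply: measurable_wrt_lincomb => //; exact: ay.
- by apply: filterS cC => w; exact: rcll_update_end.
- apply: filterS3 iC yT zeta_le => w iCw yTw zw u t u0 ut tT.
  have J0 : 0 <= J w by rewrite /J yTw; lra.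
  have [tE|tE] := eqVneq t T; have [uE|uE] := eqVneq u T => //.
  + by rewrite !mul1r ler_wpDr// iCw// -tE.
  + by exfalso; move/eqP: tE; apply; apply/le_anti; rewrite tT -[X in X <= _]uE ut.
  + exact: iCw.
- by apply: filterS C0 => w; rewrite lt_eqF.
- rewrite eqxx; apply: integral_sqr_lincomb_lty => //; first exact: mt.
    by apply: measurable_funD; apply: measurable_funM => //; exact: mt.
  apply: integral_sqr_lincomb_lty => //; first exact: mt.
  exact: (sup_sqr_lty_at P_complete W_measurable T_gt0 TT ay cy sy).
exists Z => //.
have [v [av vE cv]] := rcll_version ay cy.
apply: filterS3 eqy yT vE => w eqw yTw vw t t0T; rewrite eqxx.
have -> : \int[lebesgue_measure]_(s in `[t, T])
      g w s (if s == T then zeta w else y s w) (z s w) =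
    \int[lebesgue_measure]_(s in `[t, T]) g w s (y s w) (z s w).
  apply: eq_Rintegral_but_end => [|u uT]; last by rewrite lt_eqF.
  have := progressive_section w (driver_progressive g_coef TT av cv pz).
  have -> : driver g v z ^~ w = fun s => g w s (y s w) (z s w).
    by apply/funext => u; rewrite /driver vw.
  by apply: measurable_funS => //; apply: subset_itv; rewrite bnd_simp//; case/andP: t0T.
rewrite /J yTw; case: eqP => [->|_].
  by rewrite set_itv1 Rintegral_set1; ring.
by rewrite eqw//; ring.
Qed.
End lowering.

(** * Comparison with the minimal super-solution *)

Section comparison.
Context (R : realType) (disp : measure_display) (Omega : measurableType disp).
Context (P : probability Omega R) (d : nat) (W : R -> Omega -> 'rV[R]_d) (T : R).
Implicit Types (y C : R -> Omega -> R) (z : R -> Omega -> 'rV[R]_d).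

(** Fubini: almost every time is good, and ]a, b[ has positive length. *)
Lemma ae_time_section (Q : R -> Omega -> Prop) (a b : R) :
  ae_time P T Q -> 0 <= a -> a < b -> b <= T ->
  exists s, a < s < b /\ {ae P, forall w, Q s w}.
Proof.
move=> [A [mA A0 QA]] a0 ab bT.
have mPA : measurable_fun setT (P \o xsection A) by exact: measurable_fun_xsection.
have ae0 : ae_eq lebesgue_measure setT (P \o xsection A) (cst 0%E).
  apply/(ae_eq_integral_abs lebesgue_measure measurableT mPA).
  by under eq_integral do rewrite gee0_abs//.
apply: contrapT => noS; have [N [mN N0 PN]] := ae0.
have : (lebesgue_measure (`]a, b[ : set R) <= lebesgue_measure N)%E.
  apply: le_measure; rewrite ?inE//.
  move=> s /=; rewrite in_itv/= => sab; apply: PN => /= /(_ I) PA0.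
  apply: noS; exists s; split=> //.
  exists (xsection A s); split=> //; first exact: measurable_xsection.
  move=> w /= nQ; rewrite /xsection/= inE; apply: QA => /= h; apply: nQ; apply: h => /=.
  have /andP[as_ sb] := sab.
  by rewrite (ltW (le_lt_trans a0 as_)) (ltW (lt_le_trans sb bT)).
rewrite N0 lebesgue_measure_itv/= lte_fin ab -EFinD lee_fin.
by rewrite leNgt subr_gt0 ab.
Qed.

(** Choose good times decreasing to [t] and pass to the limit along the paths. *)
Lemma ae_time_le_rcll y y' t : ae_time P T (fun t w => y t w <= y' t w) ->
  {ae P, forall w, rcll T (y ^~ w)} -> {ae P, forall w, rcll T (y' ^~ w)} ->
  0 <= t < T -> {ae P, forall w, y t w <= y' t w}.
Proof.
move=> le_yy' cy cy' /andP[t0 tT].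
pose b n := Num.min T (t + n.+1%:R^-1).
have /choice[s sP] n : exists s, t < s < b n /\ {ae P, forall w, y s w <= y' s w}.
  apply: (ae_time_section le_yy' t0); last by rewrite ge_min lexx.
  by rewrite lt_min tT ltrDl invr_gt0/=.
have s_cvg : s n @[n --> \oo] --> t.
  apply: (@squeeze_cvgr _ _ _ _ (fun=> t) (fun n => t + n.+1%:R^-1)).
  - near=> n; have [/andP[ts sb] _] := sP n; rewrite (ltW ts)/=.
    by apply: le_trans (ltW sb) _; rewrite ge_min lexx orbT.
  - exact: cvg_cst.
  - rewrite -[X in _ --> X]addr0; apply: cvgD; first exact: cvg_cst.
    exact: cvg_harmonic.
have t0T : 0 <= t < T by rewrite t0.
have st n : t < s n by have [/andP[]] := sP n.
apply: filterS3 cy cy' (ae_foralln (fun n => (sP n).2)) => w cyw cyw' le_s.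
have /cvg_at_rightP/(_ s (conj st s_cvg)) c1 := cyw.1 t t0T.
have /cvg_at_rightP/(_ s (conj st s_cvg)) c2 := cyw'.1 t t0T.
apply: ler_cvg_to c1 c2 _; exact: nearW le_s.
Unshelve. all: by end_near. Qed.

Context (g phi : Omega -> R -> R -> 'rV[R]_d -> R) (M : R).
Hypothesis P_complete : measure_is_complete P.
Hypothesis W_measurable :
  forall (t : R) i, 0 <= t -> measurable_fun setT (fun w => W t w 0 i).
Hypothesis T_gt0 : 0 < T.
Hypothesis g_coef : coefficient P W T M g.
Hypothesis phi_coef : coefficient P W T M phi.
Hypothesis phi_ge0 :
  forall w (t : R) (y : R) (z : 'rV[R]_d), 0 <= t <= T -> 0 <= phi w t y z.

Lemma constrained_conv_lower (l : R) xi1 xi2 zeta y1 y2 z1 z2 C1 C2 :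
  0 <= l <= 1 ->
  constrained_supersolutions P W T g phi xi1 (y1, z1, C1) ->
  constrained_supersolutions P W T g phi xi2 (y2, z2, C2) ->
  L2T P W T zeta -> {ae P, forall w, zeta w <= l * xi1 w + (1 - l) * xi2 w} ->
  exists C, constrained_supersolutions P W T g phi zeta
    ((fun t w => if t == T then zeta w else l * y1 t w + (1 - l) * y2 t w),
     (fun t w => l *: z1 t w + (1 - l) *: z2 t w), C).
Proof.
move=> l01 [/= s1 f1] [/= s2 f2] zetaL zeta_le.
have [C12 s12] := supersolution_conv P_complete W_measurable T_gt0 g_coef l01 s1 s2.
have [C sC] := supersolution_lower P_complete W_measurable T_gt0 g_coef s12 zetaL zeta_le.
exists C; split=> //=.
have nT : ae_time P T (fun t w => t <> T).
  exists ([set T] `*` setT); split.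
  - exact: measurableX.
  - by rewrite product_measure1E//= lebesgue_measure_set1 mul0e.
  - move=> [t w] /= /not_implyP[_ /contrapT tT]; split=> //.
have F := ae_filter_ringOfSetsType (lebesgue_measure \x P)%E.
apply: (@filterS3 _ _ F _ _ _ _ _ f1 f2 nT) => -[t w] /= ph1 ph2 nTt t0T.
have [l0 l1] := andP l01.
case: eqP => [/(nTt t0T)//|_]; apply/le_anti; rewrite phi_ge0// andbT.
apply: le_trans (coef_convex phi_coef w t0T _ _ _ _ l01) _.
by rewrite ph1// ph2// !mulr0 addr0.
Qed.

(** Minimality against the super-solution of [constrained_conv_lower].  At time
    T, where right-continuity says nothing, the values are the terminal ones. *)
Lemma minimal_le_conv (l : R) xi1 xi2 zeta y y1 y2 z1 z2 C1 C2 t :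
  0 <= l <= 1 -> gGamma_solution P W T g phi zeta y ->
  constrained_supersolutions P W T g phi xi1 (y1, z1, C1) ->
  constrained_supersolutions P W T g phi xi2 (y2, z2, C2) ->
  L2T P W T zeta -> {ae P, forall w, zeta w <= l * xi1 w + (1 - l) * xi2 w} ->
  0 <= t <= T -> {ae P, forall w, y t w <= l * y1 t w + (1 - l) * y2 t w}.
Proof.
move=> l01 [z [C [[/= sy fy] y_min]]] c1 c2 zetaL zeta_le /andP[t0].
have [C' c'] := constrained_conv_lower l01 c1 c2 zetaL zeta_le.
have yT := supersolution_end T_gt0 sy.
rewrite le_eqVlt => /predU1P[->|tT].
  have y1T := supersolution_end T_gt0 c1.1; have y2T := supersolution_end T_gt0 c2.1.
  by apply: filterS3 (filterI y1T y2T) yT zeta_le => w [/= -> ->] ->.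
have t0T : 0 <= t < T by rewrite t0.
apply: filterS (ae_time_le_rcll (y_min _ _ _ c') (ss_y_rcll sy) (ss_y_rcll c'.1) t0T).
by move=> w /=; rewrite lt_eqF.
Qed.

(** If there were no minimal element, the value would be +oo everywhere,
    contradicting its finiteness. *)
Lemma gGamma_domain_solution xi : gGamma_domain P W T g phi xi ->
  exists y, gGamma_solution P W T g phi xi y /\
    gGamma_value P W T g phi xi = fun t w => (y t w)%:E.
Proof.
move=> [_ fin].
have [y sy] : exists y, gGamma_solution P W T g phi xi y.
  apply: contrapT => noy; move: fin; rewrite /gGamma_value xgetPN; last first.
    by move=> _ [y sy _]; apply: noy; exists y.
  move=> [N [mN N0 PN]]; have NT : N = setT.
    by apply/seteqP; split=> // w _; apply: PN => /=; rewrite ltxx.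
  by move: N0; rewrite NT probability_setT => /eqP; rewrite onee_eq0.
rewrite /gGamma_value; case: xgetP => [_ -> [y' sy' <-]|none]; first by exists y'.
by exfalso; apply: (none (fun t w => (y t w)%:E)); exists y.
Qed.

End comparison.

(** * Dominating an L2-convergent subsequence *)

Lemma ge0_cvge0P (R : realType) (u : (\bar R)^nat) : (forall n, 0 <= u n)%E ->
  u @ \oo --> 0%E <->
  (forall e : R, 0 < e -> \forall n \near \oo, (u n < e%:E)%E).
Proof.
move=> u0; split=> [u_cvg e e0|u_small A].
  by apply: (u_cvg [set x | (x < e%:E)%E]); apply: open_ereal_lt'; rewrite lte_fin.
move=> /nbhs_EFin/nbhs_ballP[e /= e0 eA].
have := u_small e e0; apply: filterS => n une.
have := u0 n; rewrite /=; case: (u n) une => [r| |]//; rewrite lte_fin lee_fin => re r0.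
by apply: eA; rewrite /ball/= sub0r normrN ger0_norm.
Qed.

Section main.
Context (R : realType) (disp : measure_display) (Omega : measurableType disp).
Context (P : probability Omega R) (d : nat) (W : R -> Omega -> 'rV[R]_d) (T : R).
Implicit Types (y C : R -> Omega -> R) (z : R -> Omega -> 'rV[R]_d).
Hypothesis P_complete : measure_is_complete P.
Hypothesis W_measurable :
  forall (t : R) i, 0 <= t -> measurable_fun setT (fun w => W t w 0 i).

(** eta is the square root of the sum of the 4^k X_k^2; where this sum is
    infinite, a null set, the real part used here is 0. *)
Lemma L2_dominating_variable (e : R) (X : nat -> Omega -> R) : 0 < e ->
  (forall k, measurable_wrt (filtration P W T) (X k)) ->
  (forall k, \int[P]_w (`|X k w| ^+ 2)%:E <= (e / (2 ^ k.+1)%:R / 4 ^+ k)%:E)%E ->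
  exists eta, [/\ measurable_wrt (filtration P W T) eta,
    (\int[P]_w (`|eta w| ^+ 2)%:E <= e%:E)%E &
    {ae P, forall w, forall k, `|X k w| <= 2 ^- k * eta w}].
Proof.
move=> e0 mX X_small.
pose S w : \bar R := (\sum_(0 <= k <oo) (4 ^+ k * `|X k w| ^+ 2)%:E)%E.
have u0 k w : (0 <= (4 ^+ k * `|X k w| ^+ 2)%:E)%E.
  by rewrite lee_fin mulr_ge0// ?exprn_ge0 ?sqr_ge0.
have mu k : measurable_fun setT
    ((fun w => (4 ^+ k * `|X k w| ^+ 2)%:E) : Omega_at P W T -> \bar R).
  apply/measurable_EFinP; apply: measurable_funM => //; apply: measurable_funX.
  by apply: measurableT_comp => //; exact/measurable_wrtP.
have mS : measurable_fun setT (S : Omega_at P W T -> \bar R).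
  exact: ge0_emeasurable_sum.
have S0 w : (0 <= S w)%E by exact: nneseries_ge0.
have intS : (\int[P]_w S w <= e%:E)%E.
  rewrite integral_nneseries//; last first.
    by move=> k; exact: measurable_fun_Omega_at (mu k).
  apply: le_trans (epsilon_trick0 xpredT (ltW e0)).
  apply: lee_nneseries => [k _ _|k _]; first by apply: integral_ge0 => w _; exact: u0.
  under eq_integral do rewrite EFinM.
  rewrite ge0_integralZl//.
  - apply: le_trans (lee_wpmul2l _ (X_small k)) _; first by rewrite lee_fin exprn_ge0.
    by rewrite -EFinM lee_fin mulrC divfK// expf_neq0.
  - apply/measurable_EFinP; apply: measurable_funX; apply: measurableT_comp => //.
    exact: (measurable_wrt_measurable P_complete W_measurable (mX k)).
exists (fun w => Num.sqrt (fine (S w))); split.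
- apply/measurable_wrtP; apply: measurableT_comp; last exact: measurableT_comp mS.
  by apply: continuous_measurable_fun; exact: sqrt_continuous.
- apply: le_trans intS; apply: ge0_le_integral => //.
  + apply/measurable_EFinP; apply: measurable_funX; apply: measurableT_comp => //.
    apply: measurableT_comp; last apply: measurableT_comp => //.
      by apply: continuous_measurable_fun; exact: sqrt_continuous.
    exact: measurable_fun_Omega_at mS.
  + exact: measurable_fun_Omega_at mS.
  + move=> w _; rewrite real_normK ?num_real// sqr_sqrtr ?fine_ge0//.
    by have := S0 w; case: (S w) => //= *; rewrite leey.
have Sint : P.-integrable setT S.
  apply/integrableP; split; first exact: measurable_fun_Omega_at mS.
  under eq_integral do rewrite gee0_abs//.
  exact: le_lt_trans intS (ltry _).
apply: filterS (integrable_ae measurableT Sint) => w /(_ I) Sw k.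
have : ((4 ^+ k * `|X k w| ^+ 2)%:E <= S w)%E.
  rewrite /S (@nneseriesD1 _ (fun k => (4 ^+ k * `|X k w| ^+ 2)%:E) k)// leeDl//.
  exact: nneseries_ge0.
rewrite -[X in (_ <= X)%E -> _]fineK// lee_fin => h.
rewrite ler_pdivlMl ?exprn_gt0// -ler_sqr ?nnegrE ?mulr_ge0 ?exprn_ge0 ?sqrtr_ge0//.
rewrite sqr_sqrtr ?fine_ge0// exprMn -exprM mulnC exprM.
by rewrite (_ : 2 ^+ 2 = 4)//; ring.
Qed.
End main.

(** * Continuity *)

Section continuity.
Context (R : realType) (disp : measure_display) (Omega : measurableType disp).
Context (P : probability Omega R) (d : nat) (W : R -> Omega -> 'rV[R]_d) (T : R).
Context (g phi : Omega -> R -> R -> 'rV[R]_d -> R) (M : R).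
Hypothesis P_complete : measure_is_complete P.
Hypothesis W_measurable :
  forall (t : R) i, 0 <= t -> measurable_fun setT (fun w => W t w 0 i).
Hypothesis T_gt0 : 0 < T.
Hypothesis g_coef : coefficient P W T M g.
Hypothesis phi_coef : coefficient P W T M phi.
Hypothesis phi_ge0 :
  forall w (t : R) (y : R) (z : 'rV[R]_d), 0 <= t <= T -> 0 <= phi w t y z.

(** [minimal_le_conv] for zeta <= a (xi + eta) + (1 - a) xi bounds x - y from
    above.  The bound from below is the same inequality with the roles of xi
    and zeta exchanged, for the weight a / (1 + a): multiplied by 1 + a it reads
    (1 + a) xi <= a (xi + eta) + zeta. *)
Lemma gGamma_solution_dist_le (a : R) xi zeta eta x y Y t : 0 < a <= 1 ->
  L2T P W T xi -> L2T P W T zeta ->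
  gGamma_solution P W T g phi xi y -> gGamma_solution P W T g phi zeta x ->
  gGamma_solution P W T g phi (fun w => xi w + eta w) Y ->
  {ae P, forall w, `|zeta w - xi w| <= a * eta w} -> 0 <= t <= T ->
  {ae P, forall w, `|x t w - y t w| <= a * `|Y t w - y t w|}.
Proof.
move=> /andP[a0 a1] xiL zetaL ys xs Ys dist t0T.
have [zy [Cy [cy _]]] := ys; have [zx [Cx [cx _]]] := xs.
have [zY [CY [cY _]]] := Ys.
have a1_gt0 : 0 < 1 + a by rewrite addr_gt0.
have l01 : 0 <= a / (1 + a) <= 1.
  apply/andP; split; first exact/ltW/divr_gt0.
  by rewrite ler_pdivrMr// mul1r lerDr.
have upper : {ae P, forall w, x t w <= a * Y t w + (1 - a) * y t w}.
  apply: (minimal_le_conv P_complete W_measurable T_gt0 g_coef phi_coef phi_ge0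
    _ xs cY cy zetaL _ t0T); first by rewrite (ltW a0).
  by apply: filterS dist => w; rewrite ler_distl => /andP[_]; lra.
have lower : {ae P, forall w,
    y t w <= a / (1 + a) * Y t w + (1 - a / (1 + a)) * x t w}.
  apply: (minimal_le_conv P_complete W_measurable T_gt0 g_coef phi_coef phi_ge0
    l01 ys cY cx xiL _ t0T).
  apply: filterS dist => w; rewrite ler_distl => /andP[h _].
  rewrite -(ler_pM2l a1_gt0) -subr_ge0.
  rewrite (_ : _ - _ = zeta w - (xi w - a * eta w)) ?subr_ge0//.
  by field; rewrite gt_eqF.
apply: filterS2 upper lower => w up; rewrite -(ler_pM2l a1_gt0).
rewrite (_ : (1 + a) * (_ + _) = a * Y t w + x t w); last by field; rewrite gt_eqF.
move=> lo; rewrite -[X in X * `|_|](gtr0_norm a0) -normrM.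
by apply: le_trans (ler_norm _); rewrite ler_norml; lra.
Qed.

Lemma gGamma_solution_sqr_lty xi y t : gGamma_solution P W T g phi xi y ->
  0 <= t <= T ->
  measurable_fun setT (y t) /\ (\int[P]_w (`|y t w| ^+ 2)%:E < +oo)%E.
Proof.
move=> [z [C [[/= s _] _]]] t0T; have ay := ss_y_adapted s; split.
  exact: (measurable_wrt_measurable P_complete W_measurable (ay t t0T)).
exact: (sup_sqr_lty_at P_complete W_measurable T_gt0 t0T ay (ss_y_rcll s) (ss_y_sup s)).
Qed.

End continuity.

Theorem theorem3p3 (R : realType) (disp : measure_display)
    (Omega : measurableType disp) (P : probability Omega R)
    (d : nat) (W : R -> Omega -> 'rV[R]_d) (T : R)
    (g phi : Omega -> R -> R -> 'rV[R]_d -> R) (M : R)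
    (complete_P : measure_is_complete P)
    (d_gt0 : (0 < d)%N)
    (W_brownian : brownian_motion P W)
    (T_gt0 : 0 < T)
    (M_gt0 : 0 < M)
    (g_coef : coefficient P W T M g)
    (phi_coef : coefficient P W T M phi)
    (phi_ge0 : forall w (t : R) y z, 0 <= t <= T -> 0 <= phi w t y z)
    (D_closed : L2_closed P W T (gGamma_domain P W T g phi))
    (xi : Omega -> R) (xi_ : nat -> Omega -> R)
    (xi_int : L2_interior P W T (gGamma_domain P W T g phi) xi)
    (xi_n_int : forall n, L2_interior P W T (gGamma_domain P W T g phi) (xi_ n))
    (xi_cvg : (\int[P]_w (`|xi_ n w - xi w| ^+ 2)%:E)%E @[n --> \oo] --> 0%E)
    (t : R) (t_range : 0 <= t <= T) :
  (\int[P]_w (`|gGamma_value P W T g phi (xi_ n) t w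
                - gGamma_value P W T g phi xi t w| ^+ 2))%E
    @[n --> \oo] --> 0%E.
Proof.
have W_meas := bm_measurable W_brownian.
have interior_sub zeta : L2_interior P W T (gGamma_domain P W T g phi) zeta ->
    gGamma_domain P W T g phi zeta.
  move=> [zetaL [e e0]]; apply => //; rewrite /sqdist.
  under eq_integral do rewrite subrr normr0 expr0n/=.
  by rewrite integral0 lte_fin exprn_gt0.
have [y [ys yE]] := gGamma_domain_solution (interior_sub _ xi_int).
have /choice[x xP] n := gGamma_domain_solution (interior_sub _ (xi_n_int n)).
have [xiL [r r0 ball_xi]] := xi_int.
have xi_L n : L2T P W T (xi_ n) by have [] := xi_n_int n.
under eq_fun do under eq_integral do rewrite (xP _).2 yE -EFinB abse_EFin -EFin_expe.
have [my y2] := gGamma_solution_sqr_lty complete_P W_meas T_gt0 ys t_range.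
have mx n : measurable_fun setT (x n t).
  exact: (gGamma_solution_sqr_lty complete_P W_meas T_gt0 (xP n).1 t_range).1.
apply/ge0_cvge0P => [n|e e0].
  by apply: integral_ge0 => w _; rewrite lee_fin sqr_ge0.
apply: contrapT => not_small.
(* The bounds 4^k c_k sum to r^2 / 2, so that xi + eta stays in the open ball of
   radius r around xi. *)
pose c (k : nat) : R := r ^+ 2 / 2 / (2 ^ k.+1)%:R / 4 ^+ k.
have c0 k : 0 < c k.
  by rewrite !divr_gt0 ?exprn_gt0// ltr0n expn_gt0.
have /choice[n_ n_P] (k : nat) : exists n,
    (\int[P]_w (`|xi_ n w - xi w| ^+ 2)%:E <= (c k)%:E)%E /\
    (e%:E <= \int[P]_w (`|x n t w - y t w| ^+ 2)%:E)%E.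
  have : \forall n \near \oo, (\int[P]_w (`|xi_ n w - xi w| ^+ 2)%:E < (c k)%:E)%E.
    apply: (iffLR (ge0_cvge0P _)) xi_cvg _ (c0 k) => n.
    by apply: integral_ge0 => w _; rewrite lee_fin sqr_ge0.
  move=> close; apply: contrapT => none; apply: not_small.
  apply: filterS close => n cn; rewrite ltNge; apply/negP => en.
  by apply: none; exists n; split=> //; exact: ltW.
pose X k w := 1 * xi_ (n_ k) w + (- 1) * xi w.
have XE k w : X k w = xi_ (n_ k) w - xi w by rewrite /X; ring.
have mX k : measurable_wrt (filtration P W T) (X k).
  by apply: measurable_wrt_lincomb; [exact: (xi_L _).1|exact: xiL.1].
have X_small k : (\int[P]_w (`|X k w| ^+ 2)%:E <= (c k)%:E)%E.
  by under eq_integral do rewrite XE; exact: (n_P k).1.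
have [|eta [meta eta2 X_eta]] :=
  L2_dominating_variable complete_P W_meas _ mX X_small.
  by rewrite divr_gt0 ?exprn_gt0.
have meta' := measurable_wrt_measurable complete_P W_meas meta.
have mxi := measurable_wrt_measurable complete_P W_meas xiL.1.
have xietaD : gGamma_domain P W T g phi (fun w => xi w + eta w).
  apply: ball_xi.
    split.
      have := measurable_wrt_lincomb 1 1 xiL.1 meta.
      by congr measurable_wrt; apply/funext => w; rewrite !mul1r.
    have := integral_sqr_lincomb_lty 1 1 mxi meta' xiL.2 (le_lt_trans eta2 (ltry _)).
    by under eq_integral do rewrite !mul1r.
  rewrite /sqdist; under eq_integral do rewrite addrC addKr.
  apply: le_lt_trans eta2 _; rewrite lte_fin.
  by rewrite ltr_pdivrMr// mulr_natr mulr2n ltrDl exprn_gt0.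
have [Y [Ys _]] := gGamma_domain_solution xietaD.
have [mY Y2] := gGamma_solution_sqr_lty complete_P W_meas T_gt0 Ys t_range.
pose B := (\int[P]_w (`|1 * Y t w + (- 1) * y t w| ^+ 2)%:E)%E.
have B0 : (0 <= B)%E by apply: integral_ge0 => w _; rewrite lee_fin sqr_ge0.
have B_fin : B \is a fin_num.
  rewrite ge0_fin_numE//; exact: integral_sqr_lincomb_lty.
have bound (k : nat) : (e%:E <= (4 ^- k)%:E * B)%E.
  apply: le_trans (n_P k).2 _.
  have mB : measurable_fun setT (fun w => 1 * Y t w + (- 1) * y t w).
    by apply: measurable_funD; exact: measurable_funM.
  rewrite -ge0_integralZl//; last 1 first.
  - by apply/measurable_EFinP; apply: measurable_funX; exact: measurableT_comp.
  apply: ae_ge0_le_integral => //.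
  - apply/measurable_EFinP; apply: measurable_funX; apply: measurableT_comp => //.
    exact: measurable_funB.
  - apply/measurable_EFinP; apply: measurable_funM => //; apply: measurable_funX.
    exact: measurableT_comp.
  have a01 : 0 < (2 ^- k : R) <= 1.
    by rewrite invr_gt0 exprn_gt0//= invf_le1 ?exprn_gt0// exprn_ege1// ler1n.
  have X_eta_k : {ae P, forall w, `|xi_ (n_ k) w - xi w| <= 2 ^- k * eta w}.
    by apply: filterS X_eta => w /(_ k); rewrite XE.
  have := gGamma_solution_dist_le complete_P W_meas T_gt0 g_coef phi_coef phi_ge0
    a01 xiL (xi_L (n_ k)) ys (xP (n_ k)).1 Ys X_eta_k t_range.
  apply: filterS => w le_w _; rewrite -EFinM lee_fin.
  rewrite mul1r mulN1r (_ : 4 = 2 ^+ 2 :> R); last by ring.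
  rewrite -exprM mulnC exprM -exprVn -exprMn.
  by rewrite ler_sqr ?nnegrE// mulr_ge0// invr_ge0 exprn_ge0.
(* k < 4^k, hence this k makes 4^-k B smaller than e. *)
pose k := Num.truncn (fine B / e).
have := bound k; rewrite -[B]fineK// -EFinM lee_fin ler_pdivlMl ?exprn_gt0//.
apply/negP; rewrite -ltNge -ltr_pdivrMr//.
apply: lt_le_trans (truncnS_gt _) _.
by rewrite -/k -natrX ler_nat ltn_expl.
Qed.
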